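(* Over ZFU, SVC$^{\mathcal{A}}$ $\land$ Collection implies RP.
   Context: Urelement set theory ZFU: language $\in$ plus a unary predicate $\mathcal{A}$ for urelements; axioms Foundation, Pairing, Union, Powerset, Infinity, Separation, Replacement, Extensionality for sets, urelements have no members; a proper class of urelements allowed; no Choice. $x\preceq^* y$ means there is a surjection from $y$ onto $x$ or $x=\emptyset$; $\varphi^t$ is relativization to $t$. SVC$^{\mathcal{A}}$: there is a set $S$ such that for every set $A$ of urelements there is an ordinal $\alpha$ with $A\preceq^* S\times\alpha$. Collection (schema): $\forall w,p\,(\forall x\in w\,\exists y\,\varphi(x,y,p)\to\exists v\,\forall x\in w\,\exists y\in v\,\varphi(x,y,p))$. RP (schema): $\forall x\,\exists t\,(x\subseteq t\land t$ is a transitive set $\land\forall v\in t\,(\varphi(v)\leftrightarrow\varphi^t(v)))$. *)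

(* Defs.v *)
From Stdlib Require Import Arith.

Set Implicit Arguments.
Unset Strict Implicit.
Unset Printing Implicit Defensive.

(** * Structures for the language {∈, 𝒜} with equality *)

(* Equality of the language is interpreted by Rocq equality (normal models). *)
Record ustruct : Type := UStruct {
  carrier :> Type;
  mem : carrier -> carrier -> Prop;
  ur : carrier -> Prop
}.

Notation "x ∈ y" := (mem x y) (at level 70, no associativity).

(** * First-order formulas (de Bruijn indices) *)

Inductive form : Type :=
| FMem (i j : nat)
| FEq (i j : nat)
| FUr (i : nat)
| FNot (phi : form)
| FAnd (phi psi : form)
| FEx (phi : form).

Definition scons (T : Type) (a : T) (rho : nat -> T) (i : nat) : T :=
  match i with
  | 0 => a
  | S j => rho j
  end.

Notation "a .: rho" := (scons a rho) (at level 55, right associativity).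

Fixpoint sat (M : ustruct) (rho : nat -> M) (phi : form) : Prop :=
  match phi with
  | FMem i j => rho i ∈ rho j
  | FEq i j => rho i = rho j
  | FUr i => ur (rho i)
  | FNot p => ~ sat rho p
  | FAnd p q => sat rho p /\ sat rho q
  | FEx p => exists a : M, sat (a .: rho) p
  end.

Fixpoint free (i : nat) (phi : form) : Prop :=
  match phi with
  | FMem j k => i = j \/ i = k
  | FEq j k => i = j \/ i = k
  | FUr j => i = j
  | FNot p => free i p
  | FAnd p q => free i p \/ free i q
  | FEx p => free (S i) p
  end.

(* [relativize phi] is the formula φ^t, where t is the fresh variable 0 and
   the free variable i of φ has become i + 1.  Under d binders, t is the
   variable d, so the indices i >= d are incremented. *)
Definition bump (d i : nat) : nat := if i <? d then i else S i.

Fixpoint relativize_at (d : nat) (phi : form) : form :=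
  match phi with
  | FMem i j => FMem (bump d i) (bump d j)
  | FEq i j => FEq (bump d i) (bump d j)
  | FUr i => FUr (bump d i)
  | FNot p => FNot (relativize_at d p)
  | FAnd p q => FAnd (relativize_at d p) (relativize_at d q)
  | FEx p => FEx (FAnd (FMem 0 (S d)) (relativize_at (S d) p))
  end.

Definition relativize (phi : form) : form := relativize_at 0 phi.

(** * Set-theoretic notions inside a structure *)

Definition is_set (M : ustruct) (x : M) : Prop := ~ ur x.

Definition sub (M : ustruct) (x y : M) : Prop := forall z : M, z ∈ x -> z ∈ y.

Definition is_empty (M : ustruct) (x : M) : Prop :=
  is_set x /\ forall z : M, ~ z ∈ x.

Definition transitive_set (M : ustruct) (t : M) : Prop :=
  is_set t /\ forall y : M, y ∈ t -> sub y t.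

(* s = y ∪ {y} *)
Definition is_succ (M : ustruct) (s y : M) : Prop :=
  is_set s /\ forall z : M, z ∈ s <-> z ∈ y \/ z = y.

(* p = {a, b} *)
Definition is_upair (M : ustruct) (p a b : M) : Prop :=
  is_set p /\ forall z : M, z ∈ p <-> z = a \/ z = b.

(* p = (a, b) = {{a}, {a, b}} *)
Definition is_opair (M : ustruct) (p a b : M) : Prop :=
  exists u v : M, is_upair u a a /\ is_upair v a b /\ is_upair p u v.

(* q = x × y *)
Definition is_prod (M : ustruct) (q x y : M) : Prop :=
  is_set q /\
  forall z : M, z ∈ q <-> exists a b : M, a ∈ x /\ b ∈ y /\ is_opair z a b.

(* (a, b) ∈ f *)
Definition rel_app (M : ustruct) (f a b : M) : Prop :=
  exists p : M, is_opair p a b /\ p ∈ f.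

Definition is_function (M : ustruct) (f x y : M) : Prop :=
  is_set f /\
  (forall p : M, p ∈ f -> exists a b : M, a ∈ x /\ b ∈ y /\ is_opair p a b) /\
  (forall a : M, a ∈ x -> exists! b : M, rel_app f a b).

Definition is_surjection (M : ustruct) (f x y : M) : Prop :=
  is_function f x y /\
  forall b : M, b ∈ y -> exists a : M, a ∈ x /\ rel_app f a b.

(* x ⪯* y *)
Definition le_star (M : ustruct) (x y : M) : Prop :=
  (exists f : M, is_surjection f y x) \/ is_empty x.

Definition well_ordered_by_mem (M : ustruct) (x : M) : Prop :=
  (forall a : M, a ∈ x -> ~ a ∈ a) /\
  (forall a b c : M, a ∈ x -> b ∈ x -> c ∈ x -> a ∈ b -> b ∈ c -> a ∈ c) /\
  (forall a b : M, a ∈ x -> b ∈ x -> a ∈ b \/ a = b \/ b ∈ a) /\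
  (forall y : M, sub y x -> (exists a : M, a ∈ y) ->
     exists m : M, m ∈ y /\ forall a : M, a ∈ y -> a = m \/ m ∈ a).

(* The elements are required to be sets: otherwise {a}, for a urelement a,
   would be an ordinal. *)
Definition is_ordinal (M : ustruct) (x : M) : Prop :=
  transitive_set x /\ (forall y : M, y ∈ x -> is_set y) /\ well_ordered_by_mem x.

(** * ZFU *)

Definition Urelements_empty (M : ustruct) : Prop :=
  forall x : M, ur x -> forall y : M, ~ y ∈ x.

Definition Extensionality (M : ustruct) : Prop :=
  forall x y : M, is_set x -> is_set y ->
    (forall z : M, z ∈ x <-> z ∈ y) -> x = y.

Definition Foundation (M : ustruct) : Prop :=
  forall x : M, (exists y : M, y ∈ x) ->
    exists y : M, y ∈ x /\ forall z : M, z ∈ x -> ~ z ∈ y.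

Definition Pairing (M : ustruct) : Prop :=
  forall a b : M, exists p : M, is_upair p a b.

Definition Union (M : ustruct) : Prop :=
  forall x : M, exists u : M, is_set u /\
    forall z : M, z ∈ u <-> exists y : M, y ∈ x /\ z ∈ y.

Definition Powerset (M : ustruct) : Prop :=
  forall x : M, exists p : M, is_set p /\
    forall y : M, y ∈ p <-> is_set y /\ sub y x.

Definition Infinity (M : ustruct) : Prop :=
  exists w : M,
    (exists e : M, is_empty e /\ e ∈ w) /\
    (forall y : M, y ∈ w -> exists s : M, is_succ s y /\ s ∈ w).

(* In the schemata the parameters are the values of [rho]; only finitely many
   of them are relevant to a given formula. *)
Definition Separation (M : ustruct) : Prop :=
  forall (phi : form) (rho : nat -> M) (x : M),
    exists y : M, is_set y /\
      forall z : M, z ∈ y <-> z ∈ x /\ sat (z .: rho) phi.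

Definition Replacement (M : ustruct) : Prop :=
  forall (phi : form) (rho : nat -> M) (w : M),
    (forall x : M, x ∈ w -> exists! y : M, sat (x .: y .: rho) phi) ->
    exists v : M, forall x : M, x ∈ w ->
      exists y : M, y ∈ v /\ sat (x .: y .: rho) phi.

Record ZFU (M : ustruct) : Prop := {
  ZFU_urelements : Urelements_empty M;
  ZFU_extensionality : Extensionality M;
  ZFU_foundation : Foundation M;
  ZFU_pairing : Pairing M;
  ZFU_union : Union M;
  ZFU_powerset : Powerset M;
  ZFU_infinity : Infinity M;
  ZFU_separation : Separation M;
  ZFU_replacement : Replacement M
}.

(** * SVC^𝒜, Collection and RP *)

Definition SVC_A (M : ustruct) : Prop :=
  exists S : M, is_set S /\
    forall A : M, is_set A -> (forall a : M, a ∈ A -> ur a) ->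
      exists alpha q : M,
        is_ordinal alpha /\ is_prod q S alpha /\ le_star A q.

Definition Collection (M : ustruct) : Prop :=
  forall (phi : form) (rho : nat -> M) (w : M),
    (forall x : M, x ∈ w -> exists y : M, sat (x .: y .: rho) phi) ->
    exists v : M, forall x : M, x ∈ w ->
      exists y : M, y ∈ v /\ sat (x .: y .: rho) phi.

(* The tuple v of RP is the restriction of [rho] to the free variables of
   [phi]; no condition is put on the other values, so that the case of a
   sentence is not vacuous when t is empty. *)
Definition RP (M : ustruct) : Prop :=
  forall (phi : form) (x : M),
    exists t : M, sub x t /\ transitive_set t /\
      forall rho : nat -> M, (forall i : nat, free i phi -> rho i ∈ t) ->
        (sat rho phi <-> sat (t .: rho) (relativize phi)).

(* Main.v *)
(* Let S witness SVC and let P be its powerset.  Sending a urelement to the first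
   index at which it is hit, together with the fibre there, injects every set of
   urelements into P x alpha for some ordinal alpha.  Over each p in P the fibre
   is a set of ordinals, so a set of urelements splits into a part of bounded
   length (a subset of P x gamma) and a part X x alpha in which every fibre is
   long.  By Collection there are gamma and a set A1 of urelements such that
   whatever occurs outside A1 with length gamma occurs outside every set, with
   every ordinal length.  A pigeonhole argument over the set of possible pairs
   then yields Z and X such that every set of urelements outside A1 injects into
   Y(alpha) = Z + X x alpha for some ordinal alpha, while Y(alpha) has disjoint
   copies outside every set.  In particular Z + Z injects into some Y(beta); by
   iterating this injection omega copies of Y(alpha) fit outside every set.

   The well-ordered family Y(alpha) replaces choice.  Any two copies of
   Y(alpha) x omega are exchanged by an automorphism of the universe fixing A1, so
   it depends only on n, alpha, beta whether witnesses for parameters from the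
   alpha-th level over A1 and n copies of Y(alpha) can be found in the beta-th
   level over A1 and n + 1 copies of Y(beta).  Collection provides such a beta;
   taking the least one omega times gives ordinals alpha_n, and the union of the
   corresponding levels over a single copy of Y(sup alpha_n) x omega reflects the
   formula by the Tarski-Vaught criterion. *)

From Stdlib Require Import Arith Lia List Classical ClassicalEpsilon ssreflect.
Require Import Defs.

Set Implicit Arguments.
Unset Strict Implicit.
Unset Printing Implicit Defensive.

(** * Definable classes and functions *)

Class model (M : ustruct) : Prop := Model {
  model_ZFU : ZFU M;
  model_Collection : Collection M
}.

(** * Renaming of variables and the coincidence lemma *)

Fixpoint rename (g : nat -> nat) (phi : form) : form :=
  match phi with
  | FMem i j => FMem (g i) (g j)
  | FEq i j => FEq (g i) (g j)
  | FUr i => FUr (g i)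
  | FNot p => FNot (rename g p)
  | FAnd p q => FAnd (rename g p) (rename g q)
  | FEx p => FEx (rename (fun i => match i with 0 => 0 | S j => S (g j) end) p)
  end.

Lemma sat_free_ext (M : ustruct) (phi : form) (r r' : nat -> M) :
  (forall i, free i phi -> r i = r' i) -> sat r phi <-> sat r' phi.
Proof.
elim: phi r r' => [i j|i j|i|p IH|p IHp q IHq|p IH] r r' E /=.
- rewrite (E i) ?(E j) //=; by auto.
- rewrite (E i) ?(E j) //=; by auto.
- rewrite (E i) //.
- have := IH r r' E. tauto.
- have := IHp r r' (fun i h => E i (or_introl h)).
  have := IHq r r' (fun i h => E i (or_intror h)). tauto.
- have H a : sat (a .: r) p <-> sat (a .: r') p.
    by apply: IH => -[|i] h //=; apply: E.
  by split => -[a] /H; exists a.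
Qed.

Lemma sat_ext (M : ustruct) (phi : form) (r r' : nat -> M) :
  (forall i, r i = r' i) -> sat r phi <-> sat r' phi.
Proof. by move=> E; apply: sat_free_ext => i _. Qed.

Lemma sat_rename (M : ustruct) (phi : form) (g : nat -> nat) (r : nat -> M) :
  sat r (rename g phi) <-> sat (fun i => r (g i)) phi.
Proof.
elim: phi g r => [i j|i j|i|p IH|p IHp q IHq|p IH] g r //=.
- have := IH g r. tauto.
- have := IHp g r. have := IHq g r. tauto.
- split => -[a] h; exists a.
  + move/IH: h; apply: (proj1 (sat_ext _ _)) => -[|i] //.
  + apply/IH; move: h; apply: (proj1 (sat_ext _ _)) => -[|i] //.
Qed.

Section Definability.
Context {M : ustruct}.
Implicit Types (P Q : (nat -> M) -> Prop) (s t : (nat -> M) -> M).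

Definition value (r : nat -> M) (x : nat + M) : M :=
  match x with inl i => r i | inr c => c end.

(* Definability with parameters: [f] sends a variable of [phi] either to a
   variable of the environment or to a parameter. *)
Definition dform P : Prop :=
  exists (phi : form) (f : nat -> nat + M),
    forall r, sat (fun i => value r (f i)) phi <-> P r.

(** A term is handled through its graph: variable 0 holds the value, and the environment of the term
    starts at variable 1. *)
Definition dterm s : Prop := dform (fun r => r 0 = s (fun i => r (S i))).

Definition def1 (Q : M -> Prop) := dform (fun r => Q (r 0)).
Definition def2 (Q : M -> M -> Prop) := dform (fun r => Q (r 0) (r 1)).
Definition def3 (Q : M -> M -> M -> Prop) := dform (fun r => Q (r 0) (r 1) (r 2)).
Definition def4 (Q : M -> M -> M -> M -> Prop) :=
  dform (fun r => Q (r 0) (r 1) (r 2) (r 3)).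
Definition fdef1 (F : M -> M) := dterm (fun r => F (r 0)).
Definition fdef2 (F : M -> M -> M) := dterm (fun r => F (r 0) (r 1)).
Definition fdef3 (F : M -> M -> M -> M) := dterm (fun r => F (r 0) (r 1) (r 2)).

Lemma d_ext P Q : dform P -> (forall r, P r <-> Q r) -> dform Q.
Proof. move=> [phi [f H]] E. exists phi, f => r. by rewrite H. Qed.

Lemma d_ren P (g : nat -> nat) : dform P -> dform (fun r => P (fun i => r (g i))).
Proof.
move=> [phi [f H]].
exists phi, (fun i => match f i with inl j => inl (g j) | inr c => inr c end) => r.
rewrite -H. apply: sat_ext => i. by case: (f i).
Qed.

Lemma d_mem0 : def2 (@mem M).
Proof. by exists (FMem 0 1), (fun i => inl i). Qed.

Lemma d_eq0 : def2 (@eq M).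
Proof. by exists (FEq 0 1), (fun i => inl i). Qed.

Lemma d_ur0 : def1 (@ur M).
Proof. by exists (FUr 0), (fun i => inl i). Qed.

Lemma d_not P : dform P -> dform (fun r => ~ P r).
Proof. move=> [phi [f H]]. exists (FNot phi), f => r /=. by rewrite H. Qed.

Lemma even_div n : (2 * n) mod 2 = 0 /\ (2 * n) / 2 = n /\
  (2 * n + 1) mod 2 = 1 /\ (2 * n + 1) / 2 = n.
Proof.
rewrite -(Nat.Div0.add_mod_idemp_l (2 * n)) (Nat.mul_comm 2) Nat.Div0.mod_mul Nat.div_mul //.
rewrite Nat.div_add_l //=; lia.
Qed.

(* The variables of the two formulas are kept apart by parity. *)
Lemma d_and P Q : dform P -> dform Q -> dform (fun r => P r /\ Q r).
Proof.
move=> [p [f Hp]] [q [g Hq]].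
exists (FAnd (rename (fun i => 2 * i) p) (rename (fun i => 2 * i + 1) q)),
  (fun i => if i mod 2 =? 0 then f (i / 2) else g (i / 2)) => r.
cbn [sat]. rewrite !sat_rename -Hp -Hq.
have E1 := fun i => even_div i.
have A: forall i, value r (if (2 * i) mod 2 =? 0 then f (2 * i / 2) else g (2 * i / 2)) = value r (f i).
  by move=> i; case: (E1 i) => -> [-> _].
have B: forall i, value r (if (2 * i + 1) mod 2 =? 0 then f ((2 * i + 1) / 2) else g ((2 * i + 1) / 2)) = value r (g i).
  by move=> i; case: (E1 i) => _ [_ [-> ->]].
by rewrite (sat_ext p A) (sat_ext q B).
Qed.

(** All variables that [f] sends to environment variable 0 are merged into the newly bound variable.
    The others move up by one, and their environment indices drop by one. *)
Lemma d_ex (F : (nat -> M) -> M -> Prop) :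
  dform (fun r => F (fun i => r (S i)) (r 0)) -> dform (fun r => exists a, F r a).
Proof.
move=> [phi [f H]].
exists (FEx (rename (fun i => match f i with inl 0 => 0 | _ => S i end) phi)),
  (fun i => match f i with inl (S j) => inl j | x => x end) => r.
cbn [sat].
suff E a : sat (a .: (fun i => value r match f i with inl (S j) => inl j | x => x end))
    (rename (fun i => match f i with inl 0 => 0 | _ => S i end) phi) <-> F r a.
  by split => -[a] /E; exists a.
rewrite sat_rename -(H (a .: r)). apply: sat_ext => i.
by case E: (f i) => [[|j]|c] //=; rewrite E.
Qed.

Lemma d_or P Q : dform P -> dform Q -> dform (fun r => P r \/ Q r).
Proof.
move=> hP hQ. apply: (d_ext (d_not (d_and (d_not hP) (d_not hQ)))) => r; tauto.
Qed.

Lemma d_imp P Q : dform P -> dform Q -> dform (fun r => P r -> Q r).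
Proof.
move=> hP hQ. apply: (d_ext (d_or (d_not hP) hQ)) => r. tauto.
Qed.

Lemma d_iff P Q : dform P -> dform Q -> dform (fun r => P r <-> Q r).
Proof.
move=> hP hQ. exact: (d_and (d_imp hP hQ) (d_imp hQ hP)).
Qed.

Lemma d_all (F : (nat -> M) -> M -> Prop) :
  dform (fun r => F (fun i => r (S i)) (r 0)) -> dform (fun r => forall a, F r a).
Proof.
move=> h. apply: (d_ext (d_not (@d_ex (fun r a => ~ F r a) (d_not h)))) => r.
split => [H a|H [a]]; last by apply; apply: H.
by apply: NNPP => n; apply: H; exists a.
Qed.

(** Excluded middle decides [A], which is then equivalent to a tautology or to its negation. This
    disposes of propositions that do not mention the environment. *)
Lemma d_const (A : Prop) : dform (fun r => A).
Proof.
have T : dform (fun r => forall a, r 0 = a -> r 0 = a).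
  have E : dform (fun r => r 1 = r 0) by exists (FEq 1 0), inl.
  by apply: (d_all (F := fun r a => r 0 = a -> r 0 = a)); apply: d_imp.
case: (classic A) => h.
- by apply: (d_ext T); split.
- by apply: (d_ext (d_not T)); split => // H; case: H.
Qed.

Lemma d_tvar i : dterm (fun r => r i).
Proof. by exists (FEq 0 (S i)), inl. Qed.

Lemma d_tconst c : dterm (fun r => c).
Proof. by exists (FEq 0 1), (fun i => match i with 0 => inl 0 | _ => inr c end). Qed.

(** A quantifier eliminates the term: some [a] equal to [s r] satisfies [F r a]. *)
Lemma d_subst (F : (nat -> M) -> M -> Prop) s :
  dform (fun r => F (fun i => r (S i)) (r 0)) -> dterm s -> dform (fun r => F r (s r)).
Proof.
move=> hF hs.
apply: (d_ext (P := fun r => exists a, a = s r /\ F r a)).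
- exact: (d_ex (F := fun r a => a = s r /\ F r a)) (d_and hs hF).
- move=> r; split => [[a [-> //]]|h]. by exists (s r).
Qed.

Lemma d_shift s : dterm s -> dterm (fun r => s (fun i => r (S i))).
Proof.
move=> h; exact: (@d_ren (fun r => r 0 = s (fun i => r (S i))) (fun i => match i with 0 => 0 | S j => S (S j) end) h).
Qed.

Lemma d_app1 (Q : M -> Prop) s : def1 Q -> dterm s -> dform (fun r => Q (s r)).
Proof. move=> hQ. exact: (@d_subst (fun r a => Q a)). Qed.

Lemma d_app2 (Q : M -> M -> Prop) s t :
  def2 Q -> dterm s -> dterm t -> dform (fun r => Q (s r) (t r)).
Proof.
move=> hQ hs ht.
apply: (@d_subst (fun r b => Q (s r) b)) ht.
apply: (@d_subst (fun r a => Q a (r 0)) (fun r => s (fun i => r (S i)))) (d_shift hs).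
exact: hQ.
Qed.

Lemma d_app3 (Q : M -> M -> M -> Prop) s t u :
  def3 Q -> dterm s -> dterm t -> dterm u -> dform (fun r => Q (s r) (t r) (u r)).
Proof.
move=> hQ hs ht hu.
apply: (@d_subst (fun r b => Q (s r) (t r) b)) hu.
apply: (@d_subst (fun r a => Q (s (fun i => r (S i))) a (r 0)) (fun r => t (fun i => r (S i)))) (d_shift ht).
apply: (@d_subst (fun r a => Q a (r 0) (r 1)) (fun r => s (fun i => r (S (S i))))) (d_shift (d_shift hs)).
exact: hQ.
Qed.

Lemma d_app4 (Q : M -> M -> M -> M -> Prop) s t u v :
  def4 Q -> dterm s -> dterm t -> dterm u -> dterm v ->
  dform (fun r => Q (s r) (t r) (u r) (v r)).
Proof.
move=> hQ hs ht hu hv.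
apply: (@d_subst (fun r b => Q (s r) (t r) (u r) b)) hv.
apply: (@d_subst (fun r a => Q (s (fun i => r (S i))) (t (fun i => r (S i))) a (r 0)) (fun r => u (fun i => r (S i)))) (d_shift hu).
apply: (@d_subst (fun r a => Q (s (fun i => r (S (S i)))) a (r 0) (r 1)) (fun r => t (fun i => r (S (S i))))) (d_shift (d_shift ht)).
apply: (@d_subst (fun r a => Q a (r 0) (r 1) (r 2)) (fun r => s (fun i => r (S (S (S i)))))) (d_shift (d_shift (d_shift hs))).
exact: hQ.
Qed.

Lemma d_tapp1 F s : fdef1 F -> dterm s -> dterm (fun r => F (s r)).
Proof.
move=> hF hs. apply: (@d_app2 (fun v a => v = F a) (fun r => r 0)) (d_tvar 0) (d_shift hs).
exact: hF.
Qed.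

Lemma d_tapp2 F s t : fdef2 F -> dterm s -> dterm t -> dterm (fun r => F (s r) (t r)).
Proof.
move=> hF hs ht.
apply: (@d_app3 (fun v a b => v = F a b) (fun r => r 0)) (d_tvar 0) (d_shift hs) (d_shift ht).
exact: hF.
Qed.

Lemma d_tapp3 F s t u : fdef3 F -> dterm s -> dterm t -> dterm u ->
  dterm (fun r => F (s r) (t r) (u r)).
Proof.
move=> hF hs ht hu.
apply: (@d_app4 (fun v a b c => v = F a b c) (fun r => r 0)) (d_tvar 0) (d_shift hs) (d_shift ht) (d_shift hu).
exact: hF.
Qed.

Lemma d_sat phi (s : nat -> (nat -> M) -> M) :
  (forall i, dterm (s i)) -> dform (fun r => sat (fun i => s i r) phi).
Proof.
elim: phi s => [i j|i j|i|p IH|p IHp q IHq|p IH] s hs /=.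
- exact: d_app2 d_mem0 (hs i) (hs j).
- exact: d_app2 d_eq0 (hs i) (hs j).
- exact: d_app1 d_ur0 (hs i).
- exact: d_not (IH _ hs).
- exact: d_and (IHp _ hs) (IHq _ hs).
- apply: d_ex.
  apply: (d_ext (IH (fun i r => match i with 0 => r 0 | S j => s j (fun i => r (S i)) end) _)).
  + move=> [|i]; [exact: d_tvar|exact: d_shift].
  + move=> r; apply: sat_ext => -[|i] //.
Qed.

(** Brings a class into the shape of the Separation schema, with the argument at variable 0 and the
    parameters in the environment. [Q] looks at variable 0 only, so [d] may fill every other
    position. *)
Lemma d_repr1 (Q : M -> Prop) (d : M) : def1 Q ->
  exists phi rho, forall z, sat (z .: rho) phi <-> Q z.
Proof.
move=> [phi [f H]].
exists (rename (fun i => match f i with inl 0 => 0 | _ => S i end) phi),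
  (fun i => match f i with inl _ => d | inr c => c end) => z.
rewrite -(H (z .: fun _ => d)) sat_rename. apply: sat_ext => i.
by case E: (f i) => [[|j]|c] //=; rewrite E.
Qed.

Lemma d_repr2 (Q : M -> M -> Prop) (d : M) : def2 Q ->
  exists phi rho, forall x y, sat (x .: y .: rho) phi <-> Q x y.
Proof.
move=> [phi [f H]].
exists (rename (fun i => match f i with inl 0 => 0 | inl 1 => 1 | _ => S (S i) end) phi),
  (fun i => match f i with inl _ => d | inr c => c end) => x y.
rewrite -(H (x .: y .: fun _ => d)) sat_rename. apply: sat_ext => i.
by case E: (f i) => [[|[|j]]|c] //=; rewrite E.
Qed.

End Definability.

(** * Terms of set theory *)

Create HintDb dfn.

Ltac dfn_binder := fail.

Ltac dfn_def :=
  first [ assumption | solve [auto 1 with dfn nocore] ].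

(* Decides definability by recursion on the shape of the predicate; the symbols
   known to be definable are the hints in [dfn], and [dfn_binder] treats the
   operators that take a function argument. *)
Ltac dfn_step :=
  cbv beta;
  lazymatch goal with
  | |- def1 (fun _ => _) => unfold def1
  | |- def2 (fun _ => _) => unfold def2
  | |- def3 (fun _ => _) => unfold def3
  | |- def4 (fun _ => _) => unfold def4
  | |- fdef1 (fun _ => _) => unfold fdef1
  | |- fdef2 (fun _ => _) => unfold fdef2
  | |- fdef3 (fun _ => _) => unfold fdef3
  | |- def1 (_ _) => first [dfn_def | unfold def1]
  | |- def1 _ => dfn_def
  | |- def2 (_ _) => first [dfn_def | unfold def2]
  | |- def2 _ => dfn_def
  | |- def3 (_ _) => first [dfn_def | unfold def3]
  | |- def3 _ => dfn_def
  | |- def4 _ => dfn_def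
  | |- fdef1 (_ _) => first [dfn_def | unfold fdef1]
  | |- fdef1 _ => dfn_def
  | |- fdef2 (_ _) => first [dfn_def | unfold fdef2]
  | |- fdef2 _ => dfn_def
  | |- fdef3 (_ _) => first [dfn_def | unfold fdef3]
  | |- fdef3 _ => dfn_def
  | |- dform (fun r => unique _ _) => unfold unique
  | |- dform (fun r => @ex _ (unique _)) => unfold unique
  | |- dform (fun _ => ?A) => exact (d_const A)
  | |- dform (fun r => ~ @?P r) => apply (@d_not _ P)
  | |- dform (fun r => @?P r /\ @?Q r) => apply (@d_and _ P Q)
  | |- dform (fun r => @?P r \/ @?Q r) => apply (@d_or _ P Q)
  | |- dform (fun r => @?P r <-> @?Q r) => apply (@d_iff _ P Q)
  | |- dform (fun r => @ex _ (fun a => @?F r a)) => apply (@d_ex _ F)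
  | |- dform (fun r => forall a : carrier _, @?F r a) => apply (@d_all _ F)
  | |- dform (fun r => @?P r -> @?Q r) => apply (@d_imp _ P Q)
  | |- dterm (fun r => r ?i) => exact (@d_tvar _ i)
  | |- dterm (fun _ => ?c) => exact (d_tconst c)
  | |- _ =>
    first
    [ dfn_binder
    | match goal with
      | |- dform (fun r => ?Q (@?s r) (@?t r) (@?u r) (@?v r)) =>
          refine (@d_app4 _ Q s t u v _ _ _ _ _); [dfn_def | | | |]
      | |- dform (fun r => ?Q (@?s r) (@?t r) (@?u r)) =>
          refine (@d_app3 _ Q s t u _ _ _ _); [dfn_def | | |]
      | |- dform (fun r => ?Q (@?s r) (@?t r)) =>
          refine (@d_app2 _ Q s t _ _ _); [dfn_def | |]
      | |- dform (fun r => ?Q (@?s r)) =>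
          refine (@d_app1 _ Q s _ _); [dfn_def | ]
      | |- dterm (fun r => ?F (@?s r) (@?t r) (@?u r)) =>
          refine (@d_tapp3 _ F s t u _ _ _ _); [dfn_def | | |]
      | |- dterm (fun r => ?F (@?s r) (@?t r)) =>
          refine (@d_tapp2 _ F s t _ _ _); [dfn_def | |]
      | |- dterm (fun r => ?F (@?s r)) =>
          refine (@d_tapp1 _ F s _ _); [dfn_def | ]
      end ]
  end.

Ltac dfn := repeat dfn_step.

#[export] Hint Resolve d_mem0 d_eq0 d_ur0 : dfn.

(* An opaque copy of [a], which keeps unification from unfolding it. *)
Lemma seal (A : Type) (a : A) : {b : A | b = a}.
Proof. by exists a. Qed.

Definition sealed (A : Type) (a : A) : A := proj1_sig (seal a).

Lemma sealed_eq (A : Type) (a : A) : sealed a = a.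
Proof. exact: (proj2_sig (seal a)). Qed.

Section Terms.
Context {M : ustruct} {HM : model M}.
Implicit Types (x y z a b f : M).

Let HZ : ZFU M := model_ZFU.

Lemma def_is_set : def1 (@is_set M).
Proof. unfold is_set, def1. dfn. Qed.
#[local] Hint Resolve def_is_set : dfn.

Lemma def_sub : def2 (@sub M).
Proof. unfold sub, def2; dfn. Qed.

Lemma mem_set z x : z ∈ x -> is_set x.
Proof. move=> h u. exact: (ZFU_urelements HZ u h). Qed.

Lemma set_ext x y : is_set x -> is_set y -> (forall z, z ∈ x <-> z ∈ y) -> x = y.
Proof. exact: (ZFU_extensionality HZ). Qed.

Lemma separation (Q : M -> Prop) x : def1 Q ->
  exists y, is_set y /\ forall z, z ∈ y <-> z ∈ x /\ Q z.
Proof.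
move=> /(d_repr1 x) [phi [rho E]].
have [y [sy H]] := ZFU_separation HZ phi rho x.
exists y; split=> // z. by rewrite H E.
Qed.

Lemma collection (Q : M -> M -> Prop) w : def2 Q ->
  (forall x, x ∈ w -> exists y, Q x y) ->
  exists v, forall x, x ∈ w -> exists y, y ∈ v /\ Q x y.
Proof.
move=> /(d_repr2 w) [phi [rho E]] H.
have [|v Hv] := @model_Collection M HM phi rho w.
  by move=> x /H [y h]; exists y; apply/E.
exists v => x /Hv [y [h1 h2]]. by exists y; split=> //; apply/E.
Qed.

Lemma empty_exists : exists x : M, is_empty x.
Proof. by have [w [[e [h _]] _]] := ZFU_infinity HZ; exists e. Qed.

Definition emp : M := proj1_sig (constructive_indefinite_description _ empty_exists).

Lemma emp_set : is_set emp.
Proof. by rewrite /emp; case: constructive_indefinite_description => ? []. Qed.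

Lemma in_emp z : ~ z ∈ emp.
Proof. by rewrite /emp; case: constructive_indefinite_description => e [_ h] /=. Qed.

(* [iota Q] is [emp] unless exactly one element satisfies [Q]. *)
Definition iota : (M -> Prop) -> M := sealed (fun Q =>
  epsilon (inhabits emp) (fun y => unique Q y \/ (~ (exists! z, Q z)) /\ y = emp)).

Lemma iota_spec (Q : M -> Prop) :
  unique Q (iota Q) \/ (~ (exists! z, Q z)) /\ iota Q = emp.
Proof.
rewrite /iota sealed_eq.
apply: (epsilon_spec (inhabits emp) (fun y => unique Q y \/ (~ (exists! z, Q z)) /\ y = emp)).
case: (classic (exists! z, Q z)) => [[z h]|n]; [by exists z; left|by exists emp; right].
Qed.

Lemma iota_eq (Q : M -> Prop) y : unique Q y -> iota Q = y.
Proof.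
move=> U. case: (iota_spec Q) => [[h _]|[n _]].
- by case: U => _ /(_ _ h).
- by case: n; exists y.
Qed.

Lemma iota_in (Q : M -> Prop) : (exists! y, Q y) -> Q (iota Q).
Proof. by move=> [y U]; rewrite (iota_eq U); case: U. Qed.

(** The disjunction in [iota_spec] is first-order in [Q] and determines the value, so it serves as
    the graph of [iota]. *)
Lemma d_iota (Q : (nat -> M) -> M -> Prop) :
  dform (fun r => Q (fun i => r (S i)) (r 0)) -> dterm (fun r => iota (Q r)).
Proof.
move=> h.
apply: (d_ext (P := fun r => (unique (Q (fun i => r (S i))) (r 0) \/
   (~ (exists z, unique (Q (fun i => r (S i))) z)) /\ r 0 = emp))).
- have h1 : dform (fun r => Q (fun i => r (S (S i))) (r 0)).
    exact: (@d_ren _ _ (fun i => match i with 0 => 0 | S j => S (S j) end) h).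
  have h2 : dform (fun r => Q (fun i => r (S (S (S i)))) (r 0)).
    exact: (@d_ren _ _ (fun i => match i with 0 => 0 | S j => S (S (S j)) end) h).
  have h3 : dform (fun r => Q (fun i => r (S (S i))) (r 0)) by [].
  unfold unique.
  apply: d_or; [apply: d_and => //|apply: d_and; [apply: d_not|dfn]].
    apply: (@d_all _ (fun r a => Q (fun i => r (S i)) a -> r 0 = a)).
    apply: d_imp; [exact: h1|dfn].
  apply: (@d_ex _ (fun r a => Q (fun i => r (S i)) a /\ (forall b, Q (fun i => r (S i)) b -> a = b))).
  apply: d_and; first exact: h1.
  apply: (@d_all _ (fun r b => Q (fun i => r (S (S i))) b -> r 0 = b)).
  apply: d_imp; [exact: h2|dfn].
- move=> r. set q := Q _. split.
  + case=> [U|[n ->]]; first by rewrite (iota_eq U).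
    case: (iota_spec q) => [U|[_ ->//]]. by case: n; exists (iota q).
  + move=> ->. exact: iota_spec.
Qed.

Definition upair a b : M := iota (fun p => is_upair p a b).
Definition union : M -> M := sealed (fun x =>
  iota (fun u => is_set u /\ forall z, z ∈ u <-> exists y, y ∈ x /\ z ∈ y)).
Definition pow : M -> M := sealed (fun x =>
  iota (fun p => is_set p /\ forall y, y ∈ p <-> is_set y /\ sub y x)).
Definition sep : M -> (M -> Prop) -> M := sealed (fun x (Q : M -> Prop) =>
  iota (fun y => is_set y /\ forall z, z ∈ y <-> z ∈ x /\ Q z)).
Definition rep : M -> (M -> M) -> M := sealed (fun x (F : M -> M) =>
  iota (fun y => is_set y /\ forall z, z ∈ y <-> exists a, a ∈ x /\ z = F a)).
Definition pr : M -> M -> M := sealed (fun a b => upair (upair a a) (upair a b)).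
Definition cup a b : M := union (upair a b).
Definition lam x (F : M -> M) : M := rep x (fun a => pr a (F a)).

(* Any [f] codes the total map [app f], with value [emp] at the points where [f]
   is not a functional set of pairs. *)
Definition app : M -> M -> M := sealed (fun f a => iota (fun b => pr a b ∈ f)).
Definition img f x : M := rep x (app f).
Definition prd : M -> M -> M := sealed (fun x y =>
  union (rep x (fun a => rep y (fun b => pr a b)))).
Definition suc x : M := cup x (upair x x).
Definition fst : M -> M := sealed (fun x => iota (fun a => exists b, x = pr a b)).
Definition snd : M -> M := sealed (fun x => iota (fun b => exists a, x = pr a b)).
Definition ite : Prop -> M -> M -> M := sealed (fun (P : Prop) a b =>
  iota (fun y => P /\ y = a \/ ~ P /\ y = b)).

Lemma iota_set_ext (R : M -> Prop) :
  (exists y, is_set y /\ forall z, z ∈ y <-> R z) ->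
  let y := iota (fun y => is_set y /\ forall z, z ∈ y <-> R z) in
  is_set y /\ forall z, z ∈ y <-> R z.
Proof.
move=> [y [sy H]].
apply: (@iota_in (fun y => is_set y /\ forall z, z ∈ y <-> R z)).
exists y; split => // y' [sy' H'].
by apply: set_ext => // z; rewrite H H'.
Qed.

Lemma upair_spec a b : is_upair (upair a b) a b.
Proof. exact: (@iota_set_ext (fun z => z = a \/ z = b) (ZFU_pairing HZ a b)). Qed.

Lemma in_upair a b z : z ∈ upair a b <-> z = a \/ z = b.
Proof. by have [_ ->] := upair_spec a b. Qed.

Lemma in_union x z : z ∈ union x <-> exists y, y ∈ x /\ z ∈ y.
Proof. rewrite /union sealed_eq. by have [_ ->] := iota_set_ext (ZFU_union HZ x). Qed.

Lemma in_pow x y : y ∈ pow x <-> is_set y /\ sub y x.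
Proof. rewrite /pow sealed_eq. by have [_ ->] := iota_set_ext (ZFU_powerset HZ x). Qed.

Lemma in_sep x (Q : M -> Prop) z : def1 Q -> z ∈ sep x Q <-> z ∈ x /\ Q z.
Proof. by move=> hQ; rewrite /sep sealed_eq; have [_ ->] := iota_set_ext (separation x hQ). Qed.

Lemma sep_set x (Q : M -> Prop) : def1 Q -> is_set (sep x Q).
Proof. by move=> hQ; rewrite /sep sealed_eq; have [] := iota_set_ext (separation x hQ). Qed.

Lemma upair_set a b : is_set (upair a b).
Proof. by have [] := upair_spec a b. Qed.
Lemma union_set x : is_set (union x).
Proof. rewrite /union sealed_eq. by have [] := iota_set_ext (ZFU_union HZ x). Qed.
Lemma cup_set x y : is_set (cup x y).
Proof. exact: union_set. Qed.

(** Collection bounds the values, and Separation cuts the bound down to the exact image. *)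
Lemma replacement (F : M -> M) x : fdef1 F ->
  exists y, is_set y /\ forall z, z ∈ y <-> exists a, a ∈ x /\ z = F a.
Proof.
move=> hF.
have [|v Hv] := @collection (fun a z => z = F a) x _ (fun a _ => ex_intro _ (F a) eq_refl).
  exact: (@d_ren _ (fun r => r 0 = F (r 1)) (fun i => match i with 0 => 1 | _ => 0 end) hF).
have [|y [sy Hy]] := @separation (fun z => exists a, a ∈ x /\ z = F a) v; first by dfn.
exists y; split=> // z; rewrite Hy. split; first by case.
move=> [a [h E]]; split; last by exists a.
have [z' [h1 h2]] := Hv a h. by rewrite E -h2.
Qed.

Lemma rep_spec x (F : M -> M) : fdef1 F ->
  is_set (rep x F) /\ forall z, z ∈ rep x F <-> exists a, a ∈ x /\ z = F a.
Proof. by move=> hF; rewrite /rep sealed_eq; exact: iota_set_ext (replacement x hF). Qed.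

Lemma in_rep x (F : M -> M) z : fdef1 F -> z ∈ rep x F <-> exists a, a ∈ x /\ z = F a.
Proof. by move=> hF; case: (rep_spec x hF) => _ ->. Qed.

Lemma rep_set x (F : M -> M) : fdef1 F -> is_set (rep x F).
Proof. by move=> hF; case: (rep_spec x hF). Qed.

Lemma rep_ext x (F G : M -> M) : fdef1 F -> fdef1 G ->
  (forall a, a ∈ x -> F a = G a) -> rep x F = rep x G.
Proof.
move=> hF hG E. apply: set_ext; try exact: rep_set. move=> z.
rewrite !in_rep //; split=> -[a [h ->]]; exists a; split=> //; [exact: E|symmetry; exact: E].
Qed.

Lemma d_sep (s : (nat -> M) -> M) (Q : (nat -> M) -> M -> Prop) :
  dterm s -> dform (fun r => Q (fun i => r (S i)) (r 0)) ->
  dterm (fun r => sep (s r) (Q r)).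
Proof.
move=> hs hQ. rewrite /sep sealed_eq. apply: d_iota. apply: d_and; first by dfn.
apply: (@d_all _ (fun r z => z ∈ r 0 <-> z ∈ s (fun i => r (S i)) /\ Q (fun i => r (S i)) z)).
apply: d_iff; first by dfn. apply: d_and.
- apply: d_app2; [exact: d_mem0|exact: d_tvar|exact: (d_shift (d_shift hs))].
- exact: (@d_ren _ _ (fun i => match i with 0 => 0 | S j => S (S j) end) hQ).
Qed.

Lemma d_rep (s : (nat -> M) -> M) (F : (nat -> M) -> M -> M) :
  dterm s -> dterm (fun r => F (fun i => r (S i)) (r 0)) ->
  dterm (fun r => rep (s r) (F r)).
Proof.
move=> hs hF. rewrite /rep sealed_eq. apply: d_iota. apply: d_and; first by dfn.
apply: (@d_all _ (fun r z => z ∈ r 0 <-> exists a, a ∈ s (fun i => r (S i)) /\ z = F (fun i => r (S i)) a)).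
apply: d_iff; first by dfn.
apply: (@d_ex _ (fun r a => a ∈ s (fun i => r (S (S i))) /\ r 0 = F (fun i => r (S (S i))) a)).
apply: d_and.
- apply: d_app2; [exact: d_mem0|exact: d_tvar|exact: (d_shift (d_shift (d_shift hs)))].
- exact: (@d_ren _ _ (fun i => match i with 0 => 1 | 1 => 0 | S j => S (S j) end) hF).
Qed.

Lemma d_ite (P : (nat -> M) -> Prop) (s t : (nat -> M) -> M) :
  dform P -> dterm s -> dterm t -> dterm (fun r => ite (P r) (s r) (t r)).
Proof.
move=> hP hs ht. rewrite /ite sealed_eq. apply: d_iota.
have hP' : dform (fun r => P (fun i => r (S i))) by exact: (d_ren S hP).
by apply: d_or; apply: d_and => //; apply: d_not.
Qed.

Lemma ite_true (P : Prop) a b : P -> ite P a b = a.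
Proof. move=> h; rewrite /ite sealed_eq; apply: iota_eq; split; [by left|by move=> y [[_ ->]|[]]]. Qed.

Lemma ite_false (P : Prop) a b : ~ P -> ite P a b = b.
Proof. move=> h; rewrite /ite sealed_eq; apply: iota_eq; split; [by right|by move=> y [[]|[_ ->]]]. Qed.

End Terms.
#[export] Hint Resolve def_is_set def_sub : dfn.

Ltac dfn_binder ::=
  lazymatch goal with
  | |- dterm (fun r => iota (@?Q r)) => apply (@d_iota _ _ Q)
  | |- dterm (fun r => sep (@?s r) (@?Q r)) => apply (@d_sep _ _ s Q)
  | |- dterm (fun r => rep (@?s r) (@?F r)) => apply (@d_rep _ _ s F)
  | |- dterm (fun r => lam (@?s r) (@?F r)) => apply (@d_rep _ _ s (fun r y => pr y (F r y)))
  | |- dterm (fun r => ite (@?P r) (@?s r) (@?t r)) => apply (@d_ite _ _ P s t)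
  end.

Section DefinableTerms.
Context {M : ustruct} {HM : model M}.
Implicit Types (x y z a b f : M).
Lemma def_upair : fdef2 (@upair M HM).
Proof. unfold upair, is_upair, fdef2; dfn. Qed.
#[local] Hint Resolve def_upair : dfn.
Lemma def_union : fdef1 (@union M HM).
Proof. rewrite /union sealed_eq; dfn. Qed.
Lemma def_pow : fdef1 (@pow M HM).
Proof. rewrite /pow sealed_eq; dfn. Qed.
#[local] Hint Resolve def_union def_pow : dfn.
Lemma def_pr : fdef2 (@pr M HM).
Proof. rewrite /pr sealed_eq; dfn. Qed.
#[local] Hint Resolve def_pr : dfn.
Lemma def_cup : fdef2 (@cup M HM).
Proof. unfold cup, fdef2; dfn. Qed.
#[local] Hint Resolve def_cup : dfn.
Lemma def_app : fdef2 (@app M HM).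
Proof. rewrite /app sealed_eq; dfn. Qed.
#[local] Hint Resolve def_app : dfn.
Lemma def_img : fdef2 (@img M HM).
Proof. unfold img, fdef2; dfn. Qed.
Lemma def_prd : fdef2 (@prd M HM).
Proof. rewrite /prd sealed_eq; dfn. Qed.
Lemma def_suc : fdef1 (@suc M HM).
Proof. unfold suc, fdef1; dfn. Qed.
Lemma def_fst : fdef1 (@fst M HM).
Proof. rewrite /fst sealed_eq; dfn. Qed.
Lemma def_snd : fdef1 (@snd M HM).
Proof. rewrite /snd sealed_eq; dfn. Qed.
End DefinableTerms.
#[export] Hint Resolve def_upair def_union def_pow def_pr def_cup def_app def_img
  def_prd def_suc def_fst def_snd : dfn.

Section TermTheory.
Context {M : ustruct} {HM : model M}.
Implicit Types (x y z a b f : M).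

Lemma in_cup x y z : z ∈ cup x y <-> z ∈ x \/ z ∈ y.
Proof.
rewrite in_union; split.
- by move=> [u [/in_upair [->|->]]]; auto.
- by case=> h; [exists x|exists y]; split=> //; apply/in_upair; auto.
Qed.

Lemma in_suc x z : z ∈ suc x <-> z ∈ x \/ z = x.
Proof. rewrite in_cup in_upair; tauto. Qed.

Lemma upair_inj a b c d : upair a b = upair c d -> a = c /\ b = d \/ a = d /\ b = c.
Proof.
move=> E.
have h z : z = a \/ z = b <-> z = c \/ z = d by rewrite -!in_upair E.
have := proj1 (h a) (or_introl eq_refl). have := proj1 (h b) (or_intror eq_refl).
have := proj2 (h c) (or_introl eq_refl). have := proj2 (h d) (or_intror eq_refl).
intuition congruence.
Qed.

Lemma pr_inj a b c d : pr a b = pr c d -> a = c /\ b = d.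
Proof.
rewrite /pr sealed_eq => /upair_inj [[/upair_inj h1 /upair_inj h2]|[/upair_inj h1 /upair_inj h2]];
intuition congruence.
Qed.

Lemma pr_opair a b p : is_opair p a b <-> p = pr a b.
Proof.
have U q c d : is_upair q c d -> q = upair c d.
  move=> [sq h]; apply: set_ext => // [|z]; [exact: upair_set|by rewrite h in_upair].
rewrite /pr sealed_eq; split=> [[u [v [/U -> [/U -> /U ->]]]] //|->].
exists (upair a a), (upair a b); split; last split; exact: upair_spec.
Qed.

Lemma in_prd x y z : z ∈ prd x y <-> exists a b, a ∈ x /\ b ∈ y /\ z = pr a b.
Proof.
rewrite /prd sealed_eq in_union; split.
- move=> [u []]; rewrite in_rep; first by dfn.
  move=> [a [ha ->]]; rewrite in_rep; first by dfn.
  by move=> [b [hb ->]]; exists a, b.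
- move=> [a [b [ha [hb ->]]]]. exists (rep y (fun b => pr a b)); split.
  + apply/in_rep; [dfn|by exists a].
  + apply/in_rep; [dfn|by exists b].
Qed.

Lemma in_prd_pr x y a b : pr a b ∈ prd x y <-> a ∈ x /\ b ∈ y.
Proof.
rewrite in_prd; split=> [[c [d [hc [hd /pr_inj [-> ->]]]]]//|[ha hb]]. by exists a, b.
Qed.

Lemma fst_pr a b : fst (pr a b) = a.
Proof. rewrite /fst sealed_eq; apply: iota_eq; split; [by exists b|by move=> y [c /pr_inj []]]. Qed.

Lemma snd_pr a b : snd (pr a b) = b.
Proof. rewrite /snd sealed_eq; apply: iota_eq; split; [by exists a|by move=> y [c /pr_inj []]]. Qed.

Lemma app_lam x (F : M -> M) a : fdef1 F -> a ∈ x -> app (lam x F) a = F a.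
Proof.
move=> hF ha.
have L b c : pr b c ∈ lam x F <-> b ∈ x /\ c = F b.
  rewrite in_rep; first by dfn. split=> [[d [hd /pr_inj [-> ->]]]//|[hb ->]]. by exists b.
rewrite /app sealed_eq; apply: iota_eq; split; first by apply/L.
by move=> y /L [].
Qed.

Lemma in_img f x z : z ∈ img f x <-> exists a, a ∈ x /\ z = app f a.
Proof. by rewrite in_rep //; rewrite /fdef1; dfn. Qed.

Lemma lam_ext x (F G : M -> M) : fdef1 F -> fdef1 G ->
  (forall a, a ∈ x -> F a = G a) -> lam x F = lam x G.
Proof. by move=> hF hG E; apply: rep_ext; [dfn|dfn|move=> a /E ->]. Qed.

Lemma foundation x y : y ∈ x -> exists z, z ∈ x /\ forall u, u ∈ x -> ~ u ∈ z.
Proof. move=> h; apply: (ZFU_foundation model_ZFU); by exists y. Qed.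

Lemma mem_irr x : ~ x ∈ x.
Proof.
move=> h. have [|z [/in_upair hz H]] := @foundation (upair x x) x; first by apply/in_upair; auto.
have {hz} E : z = x by tauto. subst z. apply: (H x) => //. apply/in_upair; auto.
Qed.

Lemma mem_asym x y : x ∈ y -> ~ y ∈ x.
Proof.
move=> h h'. have [|z [/in_upair hz H]] := @foundation (upair x y) x; first by apply/in_upair; auto.
case: hz => E; subst z.
- apply: (H y) => //; apply/in_upair; auto.
- apply: (H x) => //; apply/in_upair; auto.
Qed.

End TermTheory.

(** * Induction, recursion and ordinals *)

Section Recursion.
Context {M : ustruct} {HM : model M}.
Implicit Types (x y z a b f m n t : M).

Definition inductive (I : M) : Prop := emp ∈ I /\ forall y, y ∈ I -> suc y ∈ I.

Lemma def_inductive : def1 inductive.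
Proof. unfold inductive; dfn. Qed.
#[local] Hint Resolve def_inductive : dfn.

Lemma omega_exists : exists w, is_set w /\ forall n, n ∈ w <-> forall I, inductive I -> n ∈ I.
Proof.
have [w [[e [[se he] ew]] hw]] := ZFU_infinity model_ZFU.
have E : e = emp.
  apply: set_ext; [exact: se|exact: emp_set|by move=> z; split=> [/he|/in_emp]].
subst e.
have S : inductive w.
  split=> // y /hw [s [[ss hs] sw]].
  have -> : suc y = s.
    apply: set_ext; [exact: cup_set|exact: ss|by move=> z; rewrite in_suc hs].
  exact: sw.
have [|y [sy Hy]] := @separation M HM (fun n => forall I, inductive I -> n ∈ I) w; first by dfn.
exists y; split=> // n; rewrite Hy. split; [by case|by move=> h; split=> //; apply: h].
Qed.

Definition omega : M := proj1_sig (constructive_indefinite_description _ omega_exists).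

Lemma omega_spec : is_set omega /\ forall n, n ∈ omega <-> forall I, inductive I -> n ∈ I.
Proof. by rewrite /omega; case: constructive_indefinite_description. Qed.

Lemma omega0 : emp ∈ omega.
Proof. by apply/(proj2 omega_spec) => I []. Qed.

Lemma omegaS n : n ∈ omega -> suc n ∈ omega.
Proof. by move=> /(proj2 omega_spec) h; apply/(proj2 omega_spec) => I [h1 h2]; apply/h2/h. Qed.

Lemma omega_ind (Q : M -> Prop) : def1 Q -> Q emp ->
  (forall n, n ∈ omega -> Q n -> Q (suc n)) -> forall n, n ∈ omega -> Q n.
Proof.
move=> hQ h0 hS n hn.
have I : inductive (sep omega Q).
  split; first by apply/in_sep => //; split=> //; exact: omega0.
  move=> y /(in_sep _ _ hQ) [h1 h2]; apply/in_sep => //; split; [exact: omegaS|exact: hS].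
by have /(in_sep _ _ hQ) [_] := proj1 (proj2 omega_spec n) hn _ I.
Qed.

Lemma omega_trans n : n ∈ omega -> sub n omega.
Proof.
move: n; apply: omega_ind; [dfn|by move=> z /in_emp|].
by move=> n hn h z /in_suc [/h|->].
Qed.

Lemma nat_trans n : n ∈ omega -> forall m, m ∈ n -> sub m n.
Proof.
move: n; apply: omega_ind; [dfn|by move=> z /in_emp|].
move=> n hn h z /in_suc [/h s|->] u hu; apply/in_suc; left=> //; exact: s.
Qed.

Lemma zero_in_suc n : n ∈ omega -> emp ∈ suc n.
Proof.
move: n; apply: omega_ind; [dfn|by apply/in_suc; right|].
by move=> n hn h; apply/in_suc; left.
Qed.

Lemma suc_in_suc n : n ∈ omega -> forall m, m ∈ n -> suc m ∈ suc n.
Proof.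
move: n; apply: omega_ind; [dfn|by move=> m /in_emp|].
move=> n hn h m /in_suc [/h|->]; first by move=> ?; apply/in_suc; left.
by apply/in_suc; right.
Qed.

Lemma suc_in_suc_inv n m : n ∈ omega -> suc m ∈ suc n -> m ∈ n.
Proof.
move=> hn /in_suc [h|<-]; last by apply/in_suc; right.
apply: (nat_trans hn h); by apply/in_suc; right.
Qed.

(** [f] lists the iterated unions of [upair x x] up to and including stage [n]. *)
Let unfolding x f n : Prop :=
  app f emp = upair x x /\ forall m, m ∈ n -> app f (suc m) = union (app f m).

Let unfolding_exists x n : n ∈ omega -> exists f, unfolding x f n.
Proof.
move: n; apply: omega_ind; first by unfold unfolding; dfn.
- exists (lam (suc emp) (fun _ => upair x x)); split.
  + apply: app_lam; [dfn|by apply/in_suc; right].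
  + by move=> m /in_emp.
- move=> n hn [f [f0 fS]].
  have D : fdef1 (fun k => ite (k = suc n) (union (app f n)) (app f k)) by dfn.
  exists (lam (suc (suc n)) (fun k => ite (k = suc n) (union (app f n)) (app f k))); split.
  + rewrite app_lam //; first by apply/zero_in_suc/omegaS.
    rewrite ite_false // => E. apply: (@in_emp _ _ n). rewrite E; by apply/in_suc; right.
  + move=> m hm. rewrite app_lam //; first by apply: suc_in_suc => //; exact: omegaS.
    rewrite app_lam //; first by apply/in_suc; left.
    have Em : m <> suc n by move=> E; subst m; exact: mem_irr hm.
    rewrite (@ite_false _ _ (m = suc n)) //.
    move/in_suc: hm => [hm|->]; last by rewrite ite_true.
    rewrite ite_false; last exact: fS.
    move=> E. have : n ∈ suc m by rewrite E; apply/in_suc; right.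
    move=> /in_suc [h|h]; [exact: mem_asym hm h|subst m; exact: mem_irr hm].
Qed.

Let unfolding_unique x f f' n n' k : n ∈ omega -> n' ∈ omega -> k ∈ omega ->
  unfolding x f n -> unfolding x f' n' -> k ∈ suc n -> k ∈ suc n' -> app f k = app f' k.
Proof.
move=> hn hn' hk [f0 fS] [g0 gS]. move: k hk.
apply: omega_ind; [dfn|by rewrite f0 g0|].
move=> k hk IH /(suc_in_suc_inv hn) h /(suc_in_suc_inv hn') h'.
by rewrite fS // gS // IH //; apply/in_suc; left.
Qed.

(* The stages [upair x x], [union (upair x x)], ... are built by hand, since
   recursion is only available once transitive closures exist. *)
Lemma transitive_closure x : exists t, transitive_set t /\ x ∈ t.
Proof.
pose S (n s : M) := exists f, unfolding x f n /\ s = @app M HM f n.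
have dS : def2 S by unfold S, unfolding; dfn.
have [//|n /(unfolding_exists x) [f hf]|v Hv] := @collection M HM S omega.
  by exists (app f n), f.
have dQ : def1 (fun s => exists n, n ∈ omega /\ S n s) by dfn.
exists (union (sep v (fun s => exists n, n ∈ omega /\ S n s))).
have T n s : n ∈ omega -> S n s -> sub s (union (sep v (fun s => exists n, n ∈ omega /\ S n s))).
  move=> hn [f [hf ->]] z hz. apply/in_union. exists (app f n); split=> //.
  apply/in_sep => //. split; last by exists n; split=> //; exists f.
  have [s' [h1 [f' [hf' E]]]] := Hv n hn.
  by rewrite (unfolding_unique hn hn hn hf hf') -?E //; apply/in_suc; right.
split; [split; first exact: union_set|].
- move=> y /in_union [s [/in_sep]] => /(_ dQ) [_ [n [hn [f [hf ->]]]]] hy z hz.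
  have [f' hf'] := unfolding_exists x (omegaS hn).
  apply: (T (suc n) (app f' (suc n))); [exact: omegaS|by exists f'|].
  have hs: n ∈ suc n by apply/in_suc; right.
  rewrite (proj2 hf') //. apply/in_union; exists y; split=> //.
  by rewrite (unfolding_unique (omegaS hn) hn hn hf' hf) //; apply/in_suc; left.
- have [f hf] := unfolding_exists x omega0.
  apply: (T emp (app f emp) omega0); first by exists f.
  by rewrite (proj1 hf); apply/in_upair; left.
Qed.

(** A counterexample lies in a transitive set. A counterexample that is minimal there is minimal in
    the universe, because its elements stay in that set. *)
Lemma eps_ind (Q : M -> Prop) : def1 Q ->
  (forall x, (forall y, y ∈ x -> Q y) -> Q x) -> forall x, Q x.
Proof.
move=> hQ H x. apply: NNPP => nx.
have [t [[st tt] xt]] := transitive_closure x.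
have dQ : def1 (fun y => ~ Q y) by dfn.
have [|z [/in_sep]] := @foundation M HM (sep t (fun y => ~ Q y)) x; first by apply/in_sep.
move=> /(_ dQ) [zt nz] hz. apply: nz. apply: H => y hy.
apply: NNPP => ny. apply: (hz y) => //. apply/in_sep => //; split=> //. exact: tt zt _ hy.
Qed.

(** * Recursion along membership, with a parameter *)

Section Rec.
Variable G : M -> M -> M -> M.
Hypothesis dG : fdef3 G.

Definition attempt p f t : Prop :=
  transitive_set t /\ forall y, y ∈ t -> app f y = G p y (lam y (app f)).

Definition rec : M -> M -> M := sealed (fun p x =>
  iota (fun v => exists f t, attempt p f t /\ x ∈ t /\ v = app f x)).

Lemma def_attempt : def3 attempt.
Proof. unfold attempt, transitive_set; dfn. Qed.
#[local] Hint Resolve def_attempt : dfn.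

Lemma def_rec : fdef2 rec.
Proof. rewrite /rec sealed_eq; dfn. Qed.
#[local] Hint Resolve def_rec : dfn.

Lemma attempt_unique p f t f' t' : attempt p f t -> attempt p f' t' ->
  forall x, x ∈ t -> x ∈ t' -> app f x = app f' x.
Proof.
move=> [[st tt] h] [[st' tt'] h']. apply: eps_ind; first by dfn.
move=> x IH xt xt'. rewrite h // h' //. congr G.
apply: lam_ext; [dfn|dfn|]. move=> a ha; apply: IH => //; [exact: tt xt _ ha|exact: tt' xt' _ ha].
Qed.

Lemma rec_attempt p f t x : attempt p f t -> x ∈ t -> rec p x = app f x.
Proof.
move=> hf xt. rewrite /rec sealed_eq; apply: iota_eq; split; first by exists f, t.
move=> y [f' [t' [hf' [xt' ->]]]]. exact: attempt_unique hf hf' x xt xt'.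
Qed.

(** Attempts agree where they overlap, so their common values are those of [rec]. On the union of
    the domains collected for the elements of [x], [rec] obeys the recursion and can be prolonged to
    [x]; no attempt has to be chosen. *)
Lemma attempt_exists p x : exists f t, attempt p f t /\ x ∈ t.
Proof.
move: x; apply: eps_ind; first by dfn.
move=> x IH.
have [||v Hv] := @collection M HM (fun y t => y ∈ t /\ exists f, attempt p f t) x;
  [dfn|by move=> y /IH [f [t [h1 h2]]]; exists t; split=> //; exists f|].
have dQ : def1 (fun t => exists f, attempt p f t) by dfn.
(* Collection may also supply sets that are not domains of attempts; separation discards them. *)
pose t0 := @union M HM (@sep M HM v (fun t => exists f, attempt p f t)).
have A0 y : y ∈ t0 <-> exists t f, t ∈ v /\ attempt p f t /\ y ∈ t.
  rewrite in_union; split.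
    by move=> [t [/(in_sep _ _ dQ) [h1 [f h2]] h3]]; exists t, f.
  by move=> [t [f [h1 [h2 h3]]]]; exists t; split=> //; apply/in_sep => //; split=> //; exists f.
have T0 y : y ∈ t0 -> sub y t0.
  move=> /A0 [t [f [h1 [h2 h3]]]] z hz. apply/A0; exists t, f; split=> //; split=> //.
  exact: (proj2 (proj1 h2) y h3 z hz).
have R0 y : y ∈ t0 -> rec p y = G p y (lam y (rec p)).
  move=> /A0 [t [f [h1 [h2 h3]]]]. rewrite (rec_attempt h2 h3) (proj2 h2) //. congr G.
  apply: lam_ext; [dfn|dfn|]. move=> a ha; symmetry; apply: (rec_attempt h2).
  exact: (proj2 (proj1 h2) y h3 a ha).
have X0 : sub x t0.
  by move=> y /Hv [t [h1 [h2 [f hf]]]]; apply/A0; exists t, f.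
have D : fdef1 (fun z => G p z (lam z (rec p))) by dfn.
exists (lam (cup t0 (upair x x)) (fun z => G p z (lam z (rec p)))), (cup t0 (upair x x)).
split; last by apply/in_cup; right; apply/in_upair; left.
have S : forall z, z ∈ cup t0 (upair x x) -> sub z t0.
  by move=> z /in_cup [/T0 //|/in_upair [] ->].
split; first split; first exact: cup_set.
- by move=> y /S h z /h h'; apply/in_cup; left.
- move=> y hy. rewrite app_lam //. congr G.
  apply: lam_ext; [dfn|dfn|]. move=> a ha.
  have a0 := S y hy a ha. rewrite app_lam //; first by apply/in_cup; left.
  exact: R0.
Qed.

Lemma rec_eq p x : rec p x = G p x (lam x (rec p)).
Proof.
have [f [t [h1 h2]]] := attempt_exists p x.
rewrite (rec_attempt h1 h2) (proj2 h1) //. congr G.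
apply: lam_ext; [dfn|dfn|]. move=> a ha; symmetry; apply: (rec_attempt h1).
exact: (proj2 (proj1 h1) x h2 a ha).
Qed.

End Rec.

(* By Foundation, such sets are well-ordered by membership. *)
Definition ord a : Prop := transitive_set a /\ forall y, y ∈ a -> transitive_set y.

Lemma def_ord : def1 ord.
Proof. unfold ord, transitive_set; dfn. Qed.
#[local] Hint Resolve def_ord : dfn.

Lemma ord_in a b : ord a -> b ∈ a -> ord b.
Proof.
move=> [[sa ta] ha] hb; split; first exact: ha.
by move=> y hy; apply: ha; apply: ta hb _ hy.
Qed.

Lemma ord_sub a b : ord a -> b ∈ a -> sub b a.
Proof. move=> [[_ h] _]; exact: h. Qed.

Lemma ord_cup a b : ord a -> ord b -> ord (cup a b).
Proof.
move=> [[sa ta] ha] [[sb tb] hb]. split; first split; first exact: cup_set.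
- by move=> y /in_cup [/ta h|/tb h] z /h h'; apply/in_cup; auto.
- by move=> y /in_cup [/ha|/hb].
Qed.

Lemma ord_union x : (forall a, a ∈ x -> ord a) -> ord (union x).
Proof.
move=> H. split; first split; first exact: union_set.
- move=> y /in_union [a [ax ya]] z hz. apply/in_union; exists a; split=> //.
  exact: (ord_sub (H a ax) ya).
- move=> y /in_union [a [/H [_ h] /h]] //.
Qed.

Lemma ord_suc a : ord a -> ord (suc a).
Proof.
move=> [[sa ta] ha]. split; first split; first exact: cup_set.
- move=> y /in_suc [/ta h|->] z hz; apply/in_suc; left=> //; exact: h.
- by move=> y /in_suc [/ha|->].
Qed.

Lemma ord_emp : ord emp.
Proof. by split; [split; [exact: emp_set|move=> y /in_emp]|move=> y /in_emp]. Qed.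

Lemma is_ordinal_ord a : is_ordinal a -> ord a.
Proof.
move=> [[sa ta] [sy [_ [tr _]]]]; split=> // y hy; split; first exact: sy.
move=> z hz u hu. have za := ta y hy z hz. exact: (tr u z y (ta z za u hu) za hy hu hz).
Qed.

Lemma omega_ord : ord omega.
Proof.
split; first (split; [exact: (proj1 omega_spec)|exact: omega_trans]).
apply: omega_ind; [by unfold transitive_set; dfn|exact: (proj1 ord_emp)|].
move=> n hn [sn tn]; split; first exact: cup_set.
move=> y /in_suc [/tn h|->] z hz; apply/in_suc; left=> //; exact: h.
Qed.

Lemma ord_tri a b : ord a -> ord b -> a ∈ b \/ a = b \/ b ∈ a.
Proof.
move=> oa ob; move: a oa b ob.
apply: (@eps_ind (fun a => ord a -> forall b, ord b -> a ∈ b \/ a = b \/ b ∈ a)); first by dfn.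
move=> a IHa oa.
apply: (@eps_ind (fun b => ord b -> a ∈ b \/ a = b \/ b ∈ a)); first by dfn.
move=> b IHb ob. case: (classic (a ∈ b)) => [|nab]; first by left.
case: (classic (b ∈ a)) => [|nba]; first by right; right.
right; left. apply: set_ext; [by case: oa => [[]]|by case: ob => [[]]|].
move=> z; split=> hz.
- have [//|[E|h]] := IHa z hz (ord_in oa hz) b ob; first by subst z.
  by case: nba; apply: (ord_sub oa hz).
- have [h|[E|//]] := IHb z hz (ord_in ob hz); last by subst z.
  by case: nab; apply: (ord_sub ob hz).
Qed.

Lemma ord_sub_or a b : ord a -> ord b -> sub a b \/ b ∈ a.
Proof.
move=> oa ob. have [h|[->|h]] := ord_tri oa ob; [left; exact: ord_sub|by left|by right].
Qed.

Lemma ord_min (Q : M -> Prop) a : def1 Q -> ord a -> Q a ->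
  exists b, (ord b /\ Q b) /\ forall c, ord c /\ Q c -> b = c \/ b ∈ c.
Proof.
move=> dQ oa qa. apply: NNPP => N.
have F : forall a, ~ (ord a /\ Q a).
  apply: eps_ind; first by dfn. move=> x IH [ox qx]. apply: N; exists x; split=> //.
  move=> c hc. have [h|[->|h]] := ord_tri ox (proj1 hc); [by right|by left|by case: (IH c h)].
exact: (F a).
Qed.

(* [least Q] is [emp] if no ordinal satisfies [Q]. *)
Definition least (Q : M -> Prop) : M :=
  iota (fun b => (ord b /\ Q b) /\ forall c, ord c /\ Q c -> b = c \/ b ∈ c).

Lemma least_spec (Q : M -> Prop) a : def1 Q -> ord a -> Q a ->
  (ord (least Q) /\ Q (least Q)) /\ forall c, ord c /\ Q c -> least Q = c \/ least Q ∈ c.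
Proof.
move=> dQ oa qa. apply: (@iota_in _ _ (fun b => (ord b /\ Q b) /\ forall c, ord c /\ Q c -> b = c \/ b ∈ c)).
have [b [hb H]] := ord_min dQ oa qa. exists b; split=> // c [hc H'].
case: (H c hc) => // h; case: (H' b hb) => // h'. by case: (mem_asym h).
Qed.

Lemma nat_ord n : n ∈ omega -> ord n.
Proof. exact: ord_in omega_ord. Qed.

End Recursion.
#[export] Hint Resolve def_ord : dfn.

(** * Sizes of sets of urelements *)

Section Embeddings.
Context {M : ustruct} {HM : model M}.
Implicit Types (x y z a b f m n t A B R X Y : M).

Definition inj_code f R : Prop :=
  forall a b, a ∈ R -> b ∈ R -> app f a = app f b -> a = b.
Definition inj R Y : Prop := exists f, (forall a, a ∈ R -> app f a ∈ Y) /\ inj_code f R.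
Definition outside B A : Prop := forall b, b ∈ B -> ur b /\ ~ b ∈ A.
Definition embeds R A : Prop :=
  exists f, (forall a, a ∈ R -> ur (app f a) /\ ~ app f a ∈ A) /\ inj_code f R.
Definition eventual R : Prop := forall A, embeds R A.
Definition plentiful X : Prop := forall al, ord al -> eventual (prd X al).

Lemma def_inj_code : def2 inj_code.
Proof. unfold inj_code; dfn. Qed.
#[local] Hint Resolve def_inj_code : dfn.
Lemma def_inj : def2 inj.
Proof. unfold inj; dfn. Qed.
Lemma def_outside : def2 outside.
Proof. unfold outside; dfn. Qed.
Lemma def_embeds : def2 embeds.
Proof. unfold embeds; dfn. Qed.
#[local] Hint Resolve def_inj def_embeds def_outside : dfn.
Lemma def_eventual : def1 eventual.
Proof. unfold eventual, def1; dfn. Qed.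
#[local] Hint Resolve def_eventual : dfn.
Lemma def_plentiful : def1 plentiful.
Proof. unfold plentiful, def1; dfn. Qed.
#[local] Hint Resolve def_plentiful : dfn.

(** Description by [iota] turns the relation into a function, so an injection can be given by cases
    without writing a term for it. *)
Lemma inj_rel (T : M -> M -> Prop) R Y : def2 T ->
  (forall a, a ∈ R -> exists b, b ∈ Y /\ T a b) ->
  (forall a b b', a ∈ R -> T a b -> T a b' -> b = b') ->
  (forall a a' b, a ∈ R -> a' ∈ R -> T a b -> T a' b -> a = a') -> inj R Y.
Proof.
move=> dT H1 H2 H3.
have D : fdef1 (fun a => iota (fun b => T a b)) by dfn.
have E a : a ∈ R -> T a (iota (fun b => T a b)).
  move=> ha. apply: (@iota_in _ _ (fun b => T a b)). have [b [_ h]] := H1 a ha.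
  exists b; split=> // b' h'. exact: H2 ha h h'.
exists (lam R (fun a => iota (fun b => T a b))); split.
- move=> a ha. rewrite app_lam //. have [b [hb h]] := H1 a ha.
  by rewrite -(H2 a _ _ ha h (E a ha)).
- move=> a b ha hb. rewrite !app_lam // => e.
  apply: (H3 a b _ ha hb (E a ha)). rewrite e. exact: E.
Qed.

Lemma inj_fun (F : M -> M) R Y : fdef1 F ->
  (forall a, a ∈ R -> F a ∈ Y) ->
  (forall a b, a ∈ R -> b ∈ R -> F a = F b -> a = b) -> inj R Y.
Proof.
move=> dF h1 h2. exists (lam R F); split.
- by move=> a ha; rewrite app_lam //; exact: h1.
- by move=> a b ha hb; rewrite !app_lam //; exact: h2.
Qed.

Lemma inj_sub R Y : sub R Y -> inj R Y.
Proof. move=> h. apply: (@inj_fun (fun a => a)); [dfn|exact: h|by []]. Qed.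

Lemma inj_refl R : inj R R.
Proof. exact: inj_sub. Qed.

Lemma inj_comp R (F : M -> M) Y f : fdef1 F -> (forall a, a ∈ R -> F a ∈ Y) ->
  (forall a b, a ∈ R -> b ∈ R -> F a = F b -> a = b) -> inj_code f Y ->
  exists g, (forall a, a ∈ R -> app g a = app f (F a)) /\ inj_code g R.
Proof.
move=> dF h1 h2 hf. have D : fdef1 (fun a => app f (F a)) by dfn.
have E : forall a, a ∈ R -> app (lam R (fun a => app f (F a))) a = app f (F a).
  by move=> a ha; rewrite app_lam.
exists (lam R (fun a => app f (F a))); split=> // a b ha hb. rewrite !E // => e.
apply: h2 => //; apply: hf => //; exact: h1.
Qed.

Lemma inj_trans R Y Z : inj R Y -> inj Y Z -> inj R Z.
Proof.
move=> [f [f1 f2]] [g [g1 g2]].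
have [|h [h1 h2]] := @inj_comp R (app f) Y g _ f1 f2 g2; first by dfn.
exists h; split=> // a ha. rewrite h1 //. exact/g1/f1.
Qed.

Lemma inj_emb R Y A : inj R Y -> embeds Y A -> embeds R A.
Proof.
move=> [f [f1 f2]] [g [g1 g2]].
have [|h [h1 h2]] := @inj_comp R (app f) Y g _ f1 f2 g2; first by dfn.
exists h; split=> // a ha. rewrite h1 //. exact/g1/f1.
Qed.

Lemma inj_ev R Y : inj R Y -> eventual Y -> eventual R.
Proof. move=> h hY A; exact: inj_emb h (hY A). Qed.

Lemma emb_anti R A A' : sub A A' -> embeds R A' -> embeds R A.
Proof. by move=> h [f [f1 f2]]; exists f; split=> // a /f1 [h1 h2]; split=> // /h. Qed.

Lemma outside_emb B A : outside B A -> embeds B A.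
Proof.
have D : fdef1 (fun a : M => a) by dfn.
move=> h; exists (lam B (fun a => a)); split.
- move=> a ha; rewrite app_lam //; exact: h.
- by move=> a b ha hb; rewrite !app_lam.
Qed.

Lemma emb_outside R A : embeds R A -> exists B, outside B A /\ inj R B.
Proof.
move=> [f [f1 f2]]. exists (img f R); split.
- by move=> b /in_img [a [/f1 h ->]].
- by exists f; split=> // a ha; apply/in_img; exists a.
Qed.

(** * Disjoint sums *)

Definition inl a : M := pr emp a.
Definition inr b : M := pr (suc emp) b.
Definition sum : M -> M -> M := sealed (fun x y =>
  cup (prd (suc emp) x) (prd (upair (suc emp) (suc emp)) y)).

Lemma def_inl : fdef1 inl.
Proof. unfold inl; dfn. Qed.
Lemma def_inr : fdef1 inr.
Proof. unfold inr; dfn. Qed.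
Lemma def_sum : fdef2 sum.
Proof. rewrite /sum sealed_eq; dfn. Qed.
#[local] Hint Resolve def_inl def_inr def_sum : dfn.

Lemma in_sum x y z : z ∈ sum x y <->
  (exists a, a ∈ x /\ z = inl a) \/ (exists b, b ∈ y /\ z = inr b).
Proof.
rewrite /sum sealed_eq in_cup !in_prd; split.
- move=> [[e [a [/in_suc [/in_emp []|->] [h ->]]]]|[e [a [/in_upair he [h ->]]]]].
  + by left; exists a.
  + by right; exists a; split=> //; congr pr; tauto.
- move=> [[a [h ->]]|[a [h ->]]]; [left|right].
  + by exists emp, a; split=> //; apply/in_suc; right.
  + by exists (suc emp), a; split=> //; apply/in_upair; left.
Qed.

Lemma inl_in x y a : inl a ∈ sum x y <-> a ∈ x.
Proof.
split=> [/in_sum [[b [h /pr_inj [_ ->]]]//|[b [_ /pr_inj [E _]]]]|h].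
- case: (@in_emp _ _ emp). rewrite {2}E. by apply/in_suc; right.
- by apply/in_sum; left; exists a.
Qed.

Lemma inr_in x y a : inr a ∈ sum x y <-> a ∈ y.
Proof.
split=> [/in_sum [[b [_ /pr_inj [E _]]]|[b [h /pr_inj [_ ->]]]]|h] //.
- case: (@in_emp _ _ emp). rewrite -{2}E. by apply/in_suc; right.
- by apply/in_sum; right; exists a.
Qed.

Lemma inl_inj a b : inl a = inl b -> a = b.
Proof. by move=> /pr_inj []. Qed.
Lemma inr_inj a b : inr a = inr b -> a = b.
Proof. by move=> /pr_inj []. Qed.
Lemma inl_inr a b : inl a <> inr b.
Proof.
move=> /pr_inj [E _]. case: (@in_emp _ _ emp). rewrite {2}E. by apply/in_suc; right.
Qed.

Lemma fst_inl a : fst (inl a) = emp.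
Proof. exact: fst_pr. Qed.

Lemma fst_inr a : fst (inr a) <> emp.
Proof. rewrite /inr fst_pr => E. case: (@in_emp _ _ emp); rewrite -{2}E; by apply/in_suc; right. Qed.

Lemma snd_inr a : snd (inr a) = a.
Proof. exact: snd_pr. Qed.

Lemma inj_sum x y x' y' : inj x x' -> inj y y' -> inj (sum x y) (sum x' y').
Proof.
move=> [f [f1 f2]] [g [g1 g2]].
apply: (@inj_rel (fun z u => (exists a, a ∈ x /\ z = inl a /\ u = inl (app f a)) \/
  (exists a, a ∈ y /\ z = inr a /\ u = inr (app g a)))); first by dfn.
- move=> z /in_sum [[a [h ->]]|[a [h ->]]].
  + exists (inl (app f a)); split; [by apply/inl_in/f1|by left; exists a].
  + exists (inr (app g a)); split; [by apply/inr_in/g1|by right; exists a].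
- move=> z u u' _ [[a [h [-> ->]]]|[a [h [-> ->]]]] [[b [h' [E ->]]]|[b [h' [E ->]]]].
  + by rewrite (inl_inj E). + by case: (inl_inr E). + by case: (inl_inr (eq_sym E)).
  + by rewrite (inr_inj E).
- move=> z u w _ _ [[a [h [-> ->]]]|[a [h [-> ->]]]] [[b [h' [-> E]]]|[b [h' [-> E]]]].
  + by rewrite (f2 a b h h' (inl_inj E)). + by case: (inl_inr E).
  + by case: (inl_inr (eq_sym E)). + by rewrite (g2 a b h h' (inr_inj E)).
Qed.

Lemma inj_prd x y x' y' : inj x x' -> inj y y' -> inj (prd x y) (prd x' y').
Proof.
move=> [f [f1 f2]] [g [g1 g2]].
apply: (@inj_fun (fun z => pr (app f (fst z)) (app g (snd z)))); first by dfn.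
- move=> z /in_prd [a [b [ha [hb ->]]]]. rewrite fst_pr snd_pr. apply/in_prd_pr; auto.
- move=> z z' /in_prd [a [b [ha [hb ->]]]] /in_prd [a' [b' [ha' [hb' ->]]]].
  rewrite !fst_pr !snd_pr => /pr_inj [/f2 E1 /g2 E2]. by rewrite E1 // E2.
Qed.

(** The copy of [y] is taken outside [A] and outside the copy of [x] already found, so the two
    copies are disjoint. *)
Lemma ev_sum x y : eventual x -> eventual y -> eventual (sum x y).
Proof.
move=> hx hy A. have [f [f1 f2]] := hx A.
have [g [g1 g2]] := hy (cup A (img f x)).
pose B := @cup M HM (@img M HM f x) (@img M HM g y).
have oB : outside B A.
  move=> b /in_cup [/in_img [a [/f1 h ->]]|/in_img [a [/g1 [h1 h2] ->]]] //.
  by split=> // h; apply: h2; apply/in_cup; left.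
apply: (@inj_emb _ B); last exact: outside_emb.
apply: (@inj_rel (fun z u => (exists a, a ∈ x /\ z = inl a /\ u = app f a) \/
  (exists a, a ∈ y /\ z = inr a /\ u = app g a))); first by dfn.
- move=> z /in_sum [[a [h ->]]|[a [h ->]]].
  + exists (app f a); split; [by apply/in_cup; left; apply/in_img; exists a|by left; exists a].
  + exists (app g a); split; [by apply/in_cup; right; apply/in_img; exists a|by right; exists a].
- move=> z u u' _ [[a [h [-> ->]]]|[a [h [-> ->]]]] [[b [h' [E ->]]]|[b [h' [E ->]]]].
  + by rewrite (inl_inj E). + by case: (inl_inr E). + by case: (inl_inr (eq_sym E)).
  + by rewrite (inr_inj E).
- have N a b : a ∈ x -> b ∈ y -> app f a <> app g b.
    move=> ha hb E. case: (g1 b hb) => _; apply. apply/in_cup; right. apply/in_img. by exists a.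
  move=> z u w _ _ [[a [h [-> ->]]]|[a [h [-> ->]]]] [[b [h' [-> E]]]|[b [h' [-> E]]]].
  + by rewrite (f2 a b h h' E). + by case: (N a b).
  + by case: (N b a). + by rewrite (g2 a b h h' E).
Qed.

(** The union of the sets supplied by Collection contains each of them, and [Q] passes to larger
    sets, so one set serves all of [w]. *)
Lemma collect_set (Q : M -> M -> Prop) w : def2 Q ->
  (forall x, x ∈ w -> exists A, Q x A) ->
  (forall x A A', sub A A' -> Q x A -> Q x A') ->
  exists A, forall x, x ∈ w -> Q x A.
Proof.
move=> dQ H mono. have [v Hv] := collection dQ H. exists (union v) => x /Hv [A [hA q]].
apply: mono q => z hz. by apply/in_union; exists A.
Qed.

Lemma collect_ord (Q : M -> M -> Prop) w : def2 Q ->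
  (forall x, x ∈ w -> exists al, ord al /\ Q x al) ->
  (forall x al be, ord al -> ord be -> sub al be -> Q x al -> Q x be) ->
  exists al, ord al /\ forall x, x ∈ w -> Q x al.
Proof.
move=> dQ H mono.
have [||v Hv] := @collection _ _ (fun x al => ord al /\ Q x al) w; [dfn|exact: H|].
have O : ord (union (sep v ord)).
  by apply: ord_union => a /in_sep []; first by dfn.
exists (union (sep v ord)); split=> // x /Hv [al [hal [oal q]]].
apply: mono q => // z hz. apply/in_union; exists al; split=> //. by apply/in_sep; first by dfn.
Qed.

(* Each of the set-many candidates that fails to be plentiful or eventual does so
   for some length and some set to be avoided; collect these. *)
Lemma plentiful_threshold P A0 : exists ga A1, ord ga /\ sub A0 A1 /\
  (forall X, X ∈ pow P -> embeds (prd X ga) A1 -> plentiful X) /\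
  (forall R, R ∈ pow (prd P ga) -> embeds R A1 -> eventual R).
Proof.
have mono X al be : sub al be -> inj (prd X al) (prd X be).
  move=> h; apply: inj_prd; [exact: inj_refl|exact: inj_sub].
have [|||ga [oga H1]] := @collect_ord (fun X al => exists A, embeds (prd X al) A -> plentiful X) (pow P);
  [by dfn| | |].
    move=> X _. case: (classic (plentiful X)) => [h|n]; first by exists emp; split; [exact: ord_emp|by exists emp].
    apply: NNPP => N. apply: n => al oal A. apply: NNPP => n. apply: N.
    exists al; split=> //; exists A => h. by case: n.
  move=> X al be _ _ s [A h]; exists A => h'. apply: h. exact: inj_emb (mono X al be s) h'.
have [|||A1 H2] := @collect_set (fun X A => embeds (prd X ga) A -> plentiful X) (pow P);
  [by dfn|exact: H1| |].
  move=> X A A' s h h'; apply: h; exact: emb_anti s h'.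
have [|||A2 H3] := @collect_set (fun R A => embeds R A -> eventual R) (pow (prd P ga)); [by dfn| | |].
    move=> R _. apply: NNPP => N. have E : eventual R; last by apply: N; exists emp.
    move=> A; apply: NNPP => n. by apply: N; exists A.
  move=> X A A' s h h'; apply: h; exact: emb_anti s h'.
exists ga, (cup A0 (cup A1 A2)). split=> //; split; first by move=> z h; apply/in_cup; left.
split.
- move=> X hX h; apply: H2 => //; apply: emb_anti h => z hz. apply/in_cup; right; apply/in_cup; by left.
- move=> X hX h; apply: H3 => //; apply: emb_anti h => z hz. apply/in_cup; right; apply/in_cup; by right.
Qed.

End Embeddings.
#[export] Hint Resolve def_inj_code def_inj def_embeds def_outside def_eventual def_plentiful def_inl def_inr def_sum : dfn.

(** * Enumerations by ordinals *)

Section Enumeration.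
Context {M : ustruct} {HM : model M}.
Implicit Types (x y z a b f m n t A B R X Y s w c : M).

Definition choice c w : Prop := forall s, sub s w -> is_set s -> (exists i, i ∈ s) -> app c s ∈ s.

(* [enum c w] lists [w] along the ordinals, where [app c] chooses an element of
   each nonempty subset of [w]; [rest c w x] is what remains before step [x]. *)
Definition enum_step c w x f : M := app c (sep w (fun i => forall y, y ∈ x -> i <> app f y)).

Lemma def_enum_step c : fdef3 (enum_step c).
Proof. unfold enum_step, fdef3; dfn. Qed.

Definition enum c : M -> M -> M := rec (enum_step c).

Lemma def_enum c : fdef2 (enum c).
Proof. exact/def_rec/def_enum_step. Qed.
#[local] Hint Resolve def_enum : dfn.

Definition rest c w x : M := sep w (fun i => forall y, y ∈ x -> i <> enum c w y).

Lemma def_rest c : fdef2 (rest c).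
Proof. unfold rest, fdef2; dfn. Qed.
#[local] Hint Resolve def_rest : dfn.

Lemma in_rest c w x i : i ∈ rest c w x <-> i ∈ w /\ forall y, y ∈ x -> i <> enum c w y.
Proof. apply: in_sep; dfn. Qed.

Lemma enum_eq c w x : enum c w x = app c (rest c w x).
Proof.
rewrite /enum rec_eq; first exact: def_enum_step.
rewrite /enum_step. congr app. apply: set_ext; try (apply: sep_set; dfn).
have D := def_enum c. unfold enum in D.
move=> z; rewrite in_rest in_sep; first by dfn.
split=> -[h1 h2]; split=> // y hy.
- by move: (h2 y hy); rewrite app_lam //; dfn.
- by rewrite app_lam //; [dfn|exact: h2].
Qed.

Lemma enum_in c w x : choice c w -> (exists i, i ∈ rest c w x) -> enum c w x ∈ rest c w x.
Proof.
move=> hc hi. rewrite enum_eq. apply: hc => //; last by apply: sep_set; dfn.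
by move=> z /in_rest [].
Qed.

Lemma enum_inj c w x y : choice c w -> ord x -> ord y ->
  (exists i, i ∈ rest c w x) -> (exists i, i ∈ rest c w y) ->
  enum c w x = enum c w y -> x = y.
Proof.
move=> hc ox oy /(enum_in hc) /in_rest [_ hx] /(enum_in hc) /in_rest [_ hy] E.
have [h|[//|h]] := ord_tri ox oy.
- by case: (hy x h).
- by case: (hx y h).
Qed.

Lemma rest_sub c w x y : sub x y -> (exists i, i ∈ rest c w y) -> exists i, i ∈ rest c w x.
Proof.
move=> h [i /in_rest [iw hi]]. exists i; apply/in_rest; split=> // z hz. exact/hi/h.
Qed.

(* Otherwise the enumeration injects the class of all ordinals into [w]. *)
Lemma choice_inj_ord c w : choice c w -> exists al, ord al /\ inj w al.
Proof.
move=> hc.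
case: (classic (exists x, ord x /\ ~ exists i, i ∈ rest c w x)) => [[x [ox hx]]|N].
- have E a : a ∈ w -> exists y, y ∈ x /\ enum c w y = a.
    move=> ha. apply: NNPP => n. apply: hx. exists a. apply/in_rest; split=> // y hy e.
    by apply: n; exists y.
  have L a : a ∈ w -> enum c w (least (fun y => y ∈ x /\ enum c w y = a)) = a /\
     least (fun y => y ∈ x /\ enum c w y = a) ∈ x.
    move=> /E [y hy].
    have [|[_ [h1 h2]] _] := @least_spec _ _ (fun y => y ∈ x /\ enum c w y = a) y _ (ord_in ox (proj1 hy)) hy; first by dfn.
    by [].
  exists x; split=> //.
  apply: (@inj_fun _ _ (fun a => least (fun y => y ∈ x /\ enum c w y = a))); first by unfold least; dfn.
  + by move=> a /L [].
  + by move=> a b /L [h _] /L [h' _] e; rewrite -h -h' e.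
- have N' x : ord x -> exists i, i ∈ rest c w x.
    by move=> ox; apply: NNPP => n; apply: N; exists x.
  have D : fdef1 (fun a => least (fun y => enum c w y = a)) by unfold least; dfn.
  (* If the enumeration never stops, every ordinal is the first step at which some element of [w]
     appears. Hence the set [O] contains all ordinals. *)
  pose (O := rep w (fun a => least (fun y => enum c w y = a))).
  have inO x : ord x -> x ∈ O.
    move=> ox. apply/in_rep => //. have /in_rest [h _] := enum_in hc (N' x ox).
    exists (enum c w x); split=> //.
    have [|[o1 e] _] := @least_spec _ _ (fun y => enum c w y = enum c w x) x _ ox eq_refl; first by dfn.
    exact: (enum_inj hc ox o1 (N' x ox) (N' _ o1) (eq_sym e)).
  have oU : ord (union (sep O ord)).
    by apply: ord_union => a /in_sep []; first by dfn.
  case: (@mem_irr _ _ (union (sep O ord))). apply/in_union.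
  exists (suc (union (sep O ord))). split; last by apply/in_suc; right.
  apply/in_sep; first by dfn. by split; [apply: inO|]; apply: ord_suc.
Qed.

(** The pair with least first coordinate, and then least second coordinate, is a choice function for
    subsets of the product. Enumeration then replaces ordinal arithmetic. *)
Lemma prd_omega_inj_ord al : ord al -> exists be, ord be /\ inj (prd al omega) be.
Proof.
move=> oal.
pose (i := fun s : M => least (fun i => exists n, n ∈ omega /\ pr i n ∈ s)).
pose (k := fun s : M => least (fun n => n ∈ omega /\ pr (i s) n ∈ s)).
have Di : fdef1 i by unfold i, least; dfn.
have Dk : fdef1 k by unfold k, least; dfn.
apply: (@choice_inj_ord (lam (pow (prd al omega)) (fun s => pr (i s) (k s)))).
move=> s hs ss [z hz]. rewrite app_lam; [dfn|by apply/in_pow|].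
have /in_prd [a [n [ha [hn E]]]] := hs z hz. subst z.
have [||[_ [m [hm h]]] _] := @least_spec _ _ (fun i => exists n, n ∈ omega /\ pr i n ∈ s) a _ (ord_in oal ha);
  [by dfn|by exists n|].
by have [||[_ [_ h']] _] := @least_spec _ _ (fun n => n ∈ omega /\ pr (i s) n ∈ s) m _ (nat_ord hm); [by dfn| |].
Qed.

Lemma ord_choice al : ord al -> exists c, choice c al.
Proof.
move=> oal. have D : fdef1 (fun s => least (fun i => i ∈ s)) by unfold least; dfn.
exists (lam (pow al) (fun s => least (fun i => i ∈ s))) => s hs ss [i hi].
rewrite app_lam //; first by apply/in_pow.
have [|[_ h] _] // := @least_spec _ _ (fun i => i ∈ s) i _ (ord_in oal (hs i hi)) hi; first by dfn.
Qed.

(* The fibre of [B] over [p] is either enumerated beyond [ga] or inside [ga]. *)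
Lemma chart_split P al ga B : ord al -> ord ga -> inj B (prd P al) ->
  exists R X, R ∈ pow (prd P ga) /\ X ∈ pow P /\
    inj R B /\ inj (prd X ga) B /\ inj B (sum R (prd X al)).
Proof.
move=> oal oga [e [e1 e2]]. have [c hc] := ord_choice oal.
(* [K p] is the fibre over [p], a set of ordinals below [al]. *)
pose (K := fun p : M => sep al (fun i => exists b, b ∈ B /\ app e b = pr p i)).
have DK : fdef1 K by unfold K; dfn.
have inK p i : i ∈ K p <-> i ∈ al /\ exists b, b ∈ B /\ app e b = pr p i.
  by apply: in_sep; dfn.
have hcK p : choice c (K p).
  by move=> s hs; apply: hc => z /hs /inK [].
(* [X] consists of the points whose fibre is not exhausted after [ga] steps. *)
pose (X := sep P (fun p => exists i, i ∈ rest c (K p) ga)).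
have inX p : p ∈ X <-> p ∈ P /\ exists i, i ∈ rest c (K p) ga by apply: in_sep; dfn.
have eB b : b ∈ B -> exists p i, p ∈ P /\ i ∈ K p /\ app e b = pr p i.
  move=> hb. have /in_prd [p [i [hp [hi E]]]] := e1 b hb.
  exists p, i; split=> //; split=> //. by apply/inK; split=> //; exists b.
pose (l := fun p i : M => least (fun xi => enum c (K p) xi = i)).
have Dl : fdef2 l by unfold l, least; dfn.
have hl p i : p ∈ P -> ~ p ∈ X -> i ∈ K p -> l p i ∈ ga /\ enum c (K p) (l p i) = i.
  move=> hp hX hi. have [xi [hxi E]] : exists xi, xi ∈ ga /\ i = enum c (K p) xi.
    apply: NNPP => n. apply: hX. apply/inX; split=> //. exists i. apply/in_rest; split=> //.
    by move=> y hy E; apply: n; exists y.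
  have oxi := ord_in oga hxi.
  have [|[o1 h1] h2] := @least_spec _ _ (fun xi => enum c (K p) xi = i) xi _ oxi (eq_sym E); first by dfn.
  split=> //. case: (h2 xi (conj oxi (eq_sym E))) => h; [by rewrite /l h|exact: (ord_sub oga hxi)].
(* On a short fibre the ordinal is replaced by its place in the enumeration, which lies below
   [ga]. *)
pose (psi := fun b : M => pr (fst (app e b)) (l (fst (app e b)) (snd (app e b)))).
have Dpsi : fdef1 psi by unfold psi; dfn.
pose (S := sep B (fun b => ~ fst (app e b) ∈ X)).
have inS b : b ∈ S <-> b ∈ B /\ ~ fst (app e b) ∈ X by apply: in_sep; dfn.
have psi_inj b b' : b ∈ S -> b' ∈ S -> psi b = psi b' -> b = b'.
  move=> /inS [hb nb] /inS [hb' nb'] /pr_inj [E1 E2]. apply: e2 => //.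
  have [p [i [hp [hi E]]]] := eB b hb. have [p' [i' [hp' [hi' E']]]] := eB b' hb'.
  move: nb nb' E1 E2. rewrite E E' !fst_pr !snd_pr => nb nb' Ep; subst p' => El.
  have [_ <-] := hl p i hp nb hi. have [_ <-] := hl p i' hp nb' hi'. by rewrite El.
exists (rep S psi), X. split; [|split; [|split; [|split]]].
- apply/in_pow; split; first by apply: rep_set.
  move=> z; rewrite in_rep // => -[b [/inS [hb nb] ->]].
  have [p [i [hp [hi E]]]] := eB b hb. move: nb.
  rewrite /psi E !fst_pr !snd_pr => nb. apply/in_prd_pr; split=> //. by case: (hl p i).
- apply/in_pow; split; first by apply: sep_set; dfn. by move=> p /inX [].
- apply: (@inj_rel _ _ (fun z b => b ∈ S /\ psi b = z)); first by dfn.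
  + move=> z; rewrite in_rep // => -[b [hb ->]]. exists b; split=> //. by case/inS: hb.
  + move=> z b b' _ [hb <-] [hb' E]. exact: psi_inj (eq_sym E).
  + by move=> z z' b _ _ [_ <-] [_ <-].
- have hen p xi : p ∈ X -> xi ∈ ga -> (exists i, i ∈ rest c (K p) xi) /\ enum c (K p) xi ∈ K p.
    move=> /inX [hp hi] hxi.
    have N : exists i, i ∈ rest c (K p) xi := rest_sub (ord_sub oga hxi) hi.
    by split=> //; case/in_rest: (enum_in (hcK p) N).
  apply: (@inj_rel _ _ (fun z b => b ∈ B /\ app e b = pr (fst z) (enum c (K (fst z)) (snd z)))); first by dfn.
  + move=> z /in_prd [p [xi [hp [hxi ->]]]]. rewrite fst_pr snd_pr.
    have [_ /inK [_ [b [hb E]]]] := hen p xi hp hxi. by exists b.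
  + move=> z b b' _ [hb E] [hb' E']. by apply: e2 => //; rewrite E E'.
  + move=> z z' b /in_prd [p [xi [hp [hxi ->]]]] /in_prd [p' [xi' [hp' [hxi' ->]]]] [_ ->] [_].
    rewrite !fst_pr !snd_pr => /pr_inj [E1 E2]; subst p'. congr pr.
    apply: (enum_inj (hcK p)) E2; try exact: ord_in oga _; [exact: (proj1 (hen p xi hp hxi))|exact: (proj1 (hen p xi' hp' hxi'))].
(* Elements over [X] keep their pair from [e] in the right summand; the others are compressed by
   [psi] into the left one. *)
- apply: (@inj_fun _ _ (fun b => ite (fst (app e b) ∈ X) (inr (app e b)) (inl (psi b)))); first by dfn.
  + move=> b hb. case: (classic (fst (app e b) ∈ X)) => h.
    * rewrite ite_true //. apply/inr_in. have [p [i [hp [hi E]]]] := eB b hb.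
      rewrite E. move: h; rewrite E fst_pr => h. apply/in_prd_pr; split=> //. by case/inK: hi.
    * rewrite ite_false //. apply/inl_in/in_rep => //. exists b; split=> //. by apply/inS.
  + move=> b b' hb hb'.
    case: (classic (fst (app e b) ∈ X)) => h; [rewrite (ite_true _ _ h)|rewrite (ite_false _ _ h)];
    (case: (classic (fst (app e b') ∈ X)) => h'; [rewrite (ite_true _ _ h')|rewrite (ite_false _ _ h')]).
    * by move=> /inr_inj; apply: e2.
    * by move=> E; case: (inl_inr (eq_sym E)).
    * by move=> E; case: (inl_inr E).
    * by move=> /inl_inj; apply: psi_inj; apply/inS.
Qed.

End Enumeration.

(** * A cofinal family of sizes *)

Section Family.
Context {M : ustruct} {HM : model M}.
Implicit Types (x y z a b f m n t p q A B R X Y S w c : M).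

(** A urelement is sent to its fibre at the least index where it is hit, paired with that index. The
    fibre is nonempty and the surjection single-valued, so the pair determines the urelement. *)
Lemma svc_chart : SVC_A M ->
  exists P, forall B, (forall b, b ∈ B -> ur b) -> exists al, ord al /\ inj B (prd P al).
Proof.
move=> [S [_ hS]]. exists (pow S) => B uB.
(* [B] might be a urelement, while [SVC_A] speaks of sets; separation gives a set with the same
   elements. *)
have sB : is_set (sep B (fun _ => True)) by apply: sep_set; dfn.
have inB b : b ∈ sep B (fun _ => True) <-> b ∈ B.
  by rewrite in_sep; [dfn|tauto].
have [|al [q [oal [[_ hq] hle]]]] := hS _ sB; first by move=> b /inB /uB.
exists al; split; first exact: is_ordinal_ord.
case: hle => [[f [[_ [_ ff]] fs]]|[_ e]]; last first.
  apply: inj_sub => b hb. by case: (e b); apply/inB.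
have app_iff z b : rel_app f z b <-> pr z b ∈ f.
  split=> [[p [/pr_opair -> //]]|h]. by exists (pr z b); split=> //; apply/pr_opair.
have fu s i b b' : s ∈ S -> i ∈ al -> pr (pr s i) b ∈ f -> pr (pr s i) b' ∈ f -> b = b'.
  move=> hs hi /app_iff h /app_iff h'.
  have [|u [_ U]] := ff (pr s i).
    by apply/hq; exists s, i; split=> //; split=> //; apply/pr_opair.
  by rewrite -(U _ h) -(U _ h').
have ex b : b ∈ B -> exists i, i ∈ al /\ exists s, s ∈ S /\ pr (pr s i) b ∈ f.
  move=> /inB /fs [z [/hq [s [i [hs [hi /pr_opair ->]]]] /app_iff h]].
  by exists i; split=> //; exists s.
pose (r := fun b : M => least (fun i => i ∈ al /\ exists s, s ∈ S /\ pr (pr s i) b ∈ f)).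
have Dr : fdef1 r by unfold r, least; dfn.
have hr b : b ∈ B -> r b ∈ al /\ exists s, s ∈ S /\ pr (pr s (r b)) b ∈ f.
  move=> /ex [i hi].
  have [|[_ h] _] // := @least_spec _ _ (fun i => i ∈ al /\ exists s, s ∈ S /\ pr (pr s i) b ∈ f)
    i _ (ord_in (is_ordinal_ord oal) (proj1 hi)) hi; first by dfn.
pose (F := fun b : M => pr (sep S (fun s => pr (pr s (r b)) b ∈ f)) (r b)).
have dQ b : def1 (fun s => pr (pr s (r b)) b ∈ f) by dfn.
apply: (@inj_fun _ _ F); first by unfold F; dfn.
- move=> b /hr [h1 h2]. apply/in_prd_pr; split=> //. apply/in_pow.
  split; first exact: sep_set. by move=> z /(in_sep _ _ (dQ b)) [].
- move=> b b' hb hb' /pr_inj [E1 E2]. have [h1 [s [hs h2]]] := hr b hb.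
  have : s ∈ sep S (fun s => pr (pr s (r b)) b ∈ f) by apply/(in_sep _ _ (dQ b)).
  rewrite E1 => /(in_sep _ _ (dQ b')) [_]. rewrite -E2 => h3. exact: fu hs h1 h2 h3.
Qed.

Lemma inj_prd_sub X al be : sub al be -> inj (prd X al) (prd X be).
Proof. move=> h; apply: inj_prd; [exact: inj_refl|exact: inj_sub]. Qed.

Lemma inj_prd_sum x y w : inj (prd (sum x y) w) (sum (prd x w) (prd y w)).
Proof.
apply: (@inj_rel _ _ (fun z u => exists a n, z = pr (inl a) n /\ u = inl (pr a n) \/
    z = pr (inr a) n /\ u = inr (pr a n))); first by dfn.
- move=> z /in_prd [e [n [/in_sum he [hn ->]]]]. case: he => [[a [ha ->]]|[a [ha ->]]].
  + exists (inl (pr a n)); split; [by apply/inl_in/in_prd_pr|by exists a, n; left].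
  + exists (inr (pr a n)); split; [by apply/inr_in/in_prd_pr|by exists a, n; right].
- move=> z u u' _ [a [n [[-> ->]|[-> ->]]]] [a' [n' [[/pr_inj [E ->] ->]|[/pr_inj [E ->] ->]]]].
  + by rewrite (inl_inj E). + by case: (inl_inr E). + by case: (inl_inr (eq_sym E)).
  + by rewrite (inr_inj E).
- move=> z u w' _ _ [a [n [[-> ->]|[-> ->]]]] [a' [n' [[-> E]|[-> E]]]].
  + by move: (inl_inj E) => /pr_inj [-> ->].
  + by case: (inl_inr E). + by case: (inl_inr (eq_sym E)).
  + by move: (inr_inj E) => /pr_inj [-> ->].
Qed.

Lemma inj_prdA x y w : inj (prd (prd x y) w) (prd x (prd y w)).
Proof.
apply: (@inj_fun _ _ (fun z => pr (fst (fst z)) (pr (snd (fst z)) (snd z)))); first by dfn.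
- move=> z /in_prd [e [n [/in_prd [a [b [ha [hb ->]]]] [hn ->]]]].
  rewrite !fst_pr !snd_pr. by apply/in_prd_pr; split=> //; apply/in_prd_pr.
- move=> z z' /in_prd [e [n [/in_prd [a [b [ha [hb ->]]]] [hn ->]]]].
  move=> /in_prd [e' [n' [/in_prd [a' [b' [ha' [hb' ->]]]] [hn' ->]]]].
  by rewrite !fst_pr !snd_pr => /pr_inj [-> /pr_inj [-> ->]].
Qed.

(** One sum dominates all the sums of length [al] that the splitting of a chart can produce. *)
Definition absorbs P ga Z X al be : Prop :=
  forall R Y, R ∈ pow (prd P ga) -> Y ∈ pow P -> eventual R -> plentiful Y ->
    inj (sum R (prd Y al)) (sum Z (prd X be)).

Lemma absorbs_anti P ga Z X al al' be : sub al al' ->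
  absorbs P ga Z X al' be -> absorbs P ga Z X al be.
Proof.
move=> s h R Y hR hY eR pY. apply: inj_trans (h R Y hR hY eR pY).
apply: inj_sum; [exact: inj_refl|exact: inj_prd_sub].
Qed.

(* For each [al], Collection puts copies of all sums of an eventual subset of
   [prd P ga] and [prd Y al], with [Y] plentiful, into one set of urelements, whose
   chart gives [Z] and [X].  There are set-many pairs [(Z, X)], so one of them
   serves all ordinals [al]. *)
Lemma universal_family P A0 :
  (forall B, (forall b, b ∈ B -> ur b) -> exists al, ord al /\ inj B (prd P al)) ->
  exists A1 Z X, sub A0 A1 /\ eventual Z /\ plentiful X /\
    forall B, outside B A1 -> exists al, ord al /\ inj B (sum Z (prd X al)).
Proof.
move=> chart. have [ga [A1 [oga [sA [hX hR]]]]] := plentiful_threshold P A0.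
(* The injections of [R] and [prd X ga] into [B] meet the two thresholds, which makes [R] eventual
   and [X] plentiful. *)
have decomp B : outside B A1 -> exists R X al, R ∈ pow (prd P ga) /\ X ∈ pow P /\ ord al /\
    eventual R /\ plentiful X /\ inj B (sum R (prd X al)).
  move=> oB. have [|al [oal hB]] := chart B; first by move=> b /oB [].
  have [R [X [h1 [h2 [h3 [h4 h5]]]]]] := chart_split oal oga hB.
  have eR : eventual R by apply: hR => //; exact: inj_emb h3 (outside_emb oB).
  have pX : plentiful X by apply: hX => //; exact: inj_emb h4 (outside_emb oB).
  by exists R, X, al.
have step al : ord al -> exists Z X be, Z ∈ pow (prd P ga) /\ X ∈ pow P /\ eventual Z /\ plentiful X /\
    ord be /\ absorbs P ga Z X al be.
  move=> oal.
  have [|||A HA] := @collect_set _ _ (fun q A => eventual (fst q) -> plentiful (snd q) ->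
      exists B, sub B A /\ outside B A1 /\ inj (sum (fst q) (prd (snd q) al)) B)
    (prd (pow (prd P ga)) (pow P)); [by dfn| | |].
      move=> q _. case: (classic (eventual (fst q) /\ plentiful (snd q))) => [[h1 h2]|n]; last first.
        by exists emp => h1 h2; case: n.
      have [B [h h']] := emb_outside (ev_sum h1 (h2 al oal) A1).
      by exists B => _ _; exists B; split=> // z.
    move=> q A A' s h h1 h2. have [B [sB hB]] := h h1 h2. exists B; split=> // z /sB; exact: s.
  have dU : def1 (fun u => ur u /\ ~ u ∈ A1) by dfn.
  have oU : outside (sep A (fun u => ur u /\ ~ u ∈ A1)) A1.
    by move=> u /(in_sep _ _ dU) [].
  have [Z [X [be [h1 [h2 [h3 [h4 [h5 h6]]]]]]]] := decomp _ oU.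
  suff abs : absorbs P ga Z X al be by exists Z, X, be.
  move=> R Y hRP hYP eR pY.
  have [|||B [sB [oB iB]]] := HA (pr R Y); [by apply/in_prd_pr|by rewrite fst_pr|by rewrite snd_pr|].
  move: iB; rewrite fst_pr snd_pr => iB. apply: (inj_trans iB). apply: inj_trans h6.
  apply: inj_sub => z hz. apply/(in_sep _ _ dU). by split; [exact: sB|exact: oB].
have [Z [X [eZ [pX H]]]] : exists Z X, eventual Z /\ plentiful X /\
    forall al, ord al -> exists be, ord be /\ absorbs P ga Z X al be.
  (* If every pair failed at some ordinal, Collection would give an ordinal at which all fail, since
     failure persists upwards by [absorbs_anti]. This contradicts [step] at that ordinal. *)
  apply: NNPP => N.
  have [|||al [oal Hal]] := @collect_ord _ _ (fun q al => ~ (eventual (fst q) /\ plentiful (snd q) /\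
      exists be, ord be /\ absorbs P ga (fst q) (snd q) al be)) (prd (pow (prd P ga)) (pow P)).
  1: unfold absorbs; dfn.
    move=> q _. apply: NNPP => n. apply: N. exists (fst q), (snd q).
    have K al : ord al -> eventual (fst q) /\ plentiful (snd q) /\
       exists be, ord be /\ absorbs P ga (fst q) (snd q) al be.
      by move=> oal; apply: NNPP => n'; apply: n; exists al.
    have [h1 [h2 _]] := K emp ord_emp. split=> //; split=> // al oal. by have [_ [_]] := K al oal.
    move=> q al be _ _ s h [h1 [h2 [de [ode h3]]]]. apply: h; split=> //; split=> //.
    exists de; split; [exact: ode|exact: absorbs_anti s h3].
  have [Z [X [be [h1 [h2 [h3 [h4 [h5 h6]]]]]]]] := step al oal.
  apply: (Hal (pr Z X)); first by apply/in_prd_pr.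
  by rewrite fst_pr snd_pr; split=> //; split=> //; exists be.
exists A1, Z, X. split=> //; split=> //; split=> // B oB.
have [R [Y [al [h1 [h2 [h3 [h4 [h5 h6]]]]]]]] := decomp B oB.
have [be [obe hbe]] := H al h3. exists be; split; first exact: obe. apply: (inj_trans h6). exact: hbe.
Qed.

(** * Iterating an injection of [Z + Z] into [Z + Q] *)

Section Doubling.
Variables (Z Q f : M).
Hypothesis f_maps : forall a, a ∈ sum Z Z -> app f a ∈ sum Z Q.
Hypothesis f_inj : inj_code f (sum Z Z).

(* The copy [inl] of [Z] is iterated, the copy [inr] is the starting point;
   an orbit that leaves [Z] for [Q] stays where it is. *)
Definition move e : M := ite (fst e = emp) (app f e) e.
(** For a nonzero natural number [n], [union n] is its predecessor. *)
Definition orbit_step z n g : M := ite (n = emp) (app f (inr z)) (move (app g (union n))).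
Definition orbit : M -> M -> M := rec orbit_step.

Lemma def_orbit : fdef2 orbit.
Proof. apply: def_rec. unfold orbit_step, move; dfn. Qed.
#[local] Hint Resolve def_orbit : dfn.

Lemma orbit_eq z n : orbit z n = orbit_step z n (lam n (orbit z)).
Proof. apply: rec_eq. unfold orbit_step, move; dfn. Qed.


Lemma orbit0 z : orbit z emp = app f (inr z).
Proof. by rewrite orbit_eq; apply: ite_true. Qed.

Lemma orbitS z n : n ∈ omega -> orbit z (suc n) = move (orbit z n).
Proof.
move=> hn. rewrite orbit_eq /orbit_step ite_false.
  by move=> E; case: (@in_emp _ _ n); rewrite -E; apply/in_suc; right.
have -> : union (suc n) = n.
  apply: set_ext; [exact: union_set|exact: (proj1 (proj1 (nat_ord hn)))|].
  move=> u; rewrite in_union; split.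
    by move=> [y [/in_suc [h|->] //]]; apply: (nat_trans hn h).
  by move=> h; exists n; split=> //; apply/in_suc; right.
rewrite app_lam //; [dfn|by apply/in_suc; right].
Qed.

Lemma sum_inl w e : e ∈ sum Z w -> fst e = emp -> exists a, a ∈ Z /\ e = inl a.
Proof. move=> /in_sum [//|[b [_ ->]]] E; by case: (fst_inr E). Qed.

Lemma orbit_in z n : z ∈ Z -> n ∈ omega -> orbit z n ∈ sum Z Q.
Proof.
move=> hz; move: n. apply: omega_ind; first by dfn.
- rewrite orbit0. apply: f_maps. by apply/inr_in.
- move=> n hn IH. rewrite orbitS // /move.
  case: (classic (fst (orbit z n) = emp)) => h; last by rewrite ite_false.
  rewrite ite_true //. apply: f_maps. have [a [ha ->]] := sum_inl IH h. by apply/inl_in.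
Qed.

Lemma orbit_back z n : z ∈ Z -> n ∈ omega -> fst (orbit z (suc n)) = emp ->
  fst (orbit z n) = emp /\ orbit z (suc n) = app f (orbit z n).
Proof.
move=> hz hn. rewrite orbitS // /move.
case: (classic (fst (orbit z n) = emp)) => h; [by rewrite !ite_true|by rewrite !ite_false].
Qed.

Lemma in_dom z n : z ∈ Z -> n ∈ omega -> fst (orbit z n) = emp -> orbit z n ∈ sum Z Z.
Proof.
move=> hz hn h. have [a [ha ->]] := sum_inl (orbit_in hz hn) h. by apply/inl_in.
Qed.

Lemma f_start z z' n : z ∈ Z -> z' ∈ Z -> n ∈ omega -> fst (orbit z n) = emp ->
  app f (orbit z n) <> app f (inr z').
Proof.
move=> hz hz' hn h E.
have E' : orbit z n = inr z' by apply: f_inj => //; [exact: in_dom|by apply/inr_in].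
move: h; rewrite E'; exact: fst_inr.
Qed.

(** Two orbits that meet inside [Z] are run backwards by cancelling [f]. By [f_start] they reach
    their starting points simultaneously, and there injectivity identifies these. *)
Lemma orbit_inj z z' n : z ∈ Z -> z' ∈ Z -> n ∈ omega -> fst (orbit z n) = emp ->
  forall m, m ∈ omega -> orbit z n = orbit z' m -> n = m /\ z = z'.
Proof.
move=> hz hz'. move: n. apply: omega_ind; first by dfn.
- move=> h0. apply: omega_ind; first by dfn.
  + rewrite !orbit0 => E. split=> //. apply: inr_inj.
    by apply: f_inj => //; apply/inr_in.
  + move=> m hm _ E. case: (@orbit_back z' m hz' hm); first by rewrite -E.
    move=> h1 h2. case: (@f_start z' z m hz' hz hm h1). by rewrite -h2 -E orbit0.
- move=> n hn IH h. have [h1 h2] := orbit_back hz hn h.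
  apply: omega_ind; first by dfn.
  + move=> E. case: (@f_start z z' n hz hz' hn h1). by rewrite -h2 E orbit0.
  + move=> m hm _ E. have [|h3 h4] := @orbit_back z' m hz' hm; first by rewrite -E.
    have E' : orbit z n = orbit z' m.
      by apply: f_inj; [exact: in_dom|exact: in_dom|rewrite -h2 -h4].
    by have [-> ->] := IH h1 m hm E'.
Qed.

(** A point outside [Z] no longer moves, so it is the image under [f] of the start or of the last
    orbit point that was still in [Z]. *)
Lemma orbit_exit z n : z ∈ Z -> n ∈ omega -> fst (orbit z n) <> emp ->
  orbit z n = app f (inr z) \/
  exists k, k ∈ omega /\ k ∈ n /\ fst (orbit z k) = emp /\ orbit z n = app f (orbit z k).
Proof.
move=> hz; move: n. apply: omega_ind; first by dfn.
- by left; rewrite orbit0.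
- move=> n hn IH. rewrite orbitS // /move.
  case: (classic (fst (orbit z n) = emp)) => h; [rewrite (ite_true _ _ h)|rewrite (ite_false _ _ h)].
  + by move=> _; right; exists n; split=> //; split=> //; apply/in_suc; right.
  + move=> /IH [->|[k [h1 [h2 h3]]]]; first by left.
    by right; exists k; split=> //; split=> //; apply/in_suc; left.
Qed.

Lemma orbit_inj_exit z z' n : z ∈ Z -> z' ∈ Z -> n ∈ omega -> orbit z n = orbit z' n -> z = z'.
Proof.
move=> hz hz'; move: n. apply: omega_ind; first by dfn.
- rewrite !orbit0 => E. apply: inr_inj. by apply: f_inj => //; apply/inr_in.
(* An orbit leaving [Z] now cannot land on one that left earlier: cancelling [f] would equate orbit
   points at the times [n] and [k], with [k] below [n]. *)
- have mixed y y' n : y ∈ Z -> y' ∈ Z -> n ∈ omega -> fst (orbit y n) = emp ->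
      fst (orbit y' n) <> emp -> app f (orbit y n) <> orbit y' n.
    move=> hy hy' hn h h' E. have [E'|[k [hk [kn [hk' E']]]]] := orbit_exit hy' hn h'.
      by case: (f_start hy hy' hn h); rewrite E E'.
    have E2 : orbit y n = orbit y' k.
      by apply: f_inj; [exact: in_dom|exact: in_dom|rewrite E E'].
    have [E3 _] := orbit_inj hy hy' hn h hk E2. by subst k; case: (mem_irr kn).
  move=> n hn IH. rewrite !orbitS // /move.
  case: (classic (fst (orbit z n) = emp)) => h; [rewrite (ite_true _ _ h)|rewrite (ite_false _ _ h)];
  (case: (classic (fst (orbit z' n) = emp)) => h'; [rewrite (ite_true _ _ h')|rewrite (ite_false _ _ h')]).
  + move=> E. apply: IH. by apply: f_inj => //; exact: in_dom.
  + by move=> E; case: (mixed z z' n).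
  + by move=> E; case: (mixed z' z n).
  + exact: IH.
Qed.

Lemma inj_prd_omega : inj (prd Z omega) (sum Z (prd Q omega)).
Proof.
pose (e := fun p : M => orbit (fst p) (snd p)).
have De : fdef1 e by unfold e; dfn.
(* A halted orbit repeats its value, so the time is stored next to it; at equal times
   [orbit_inj_exit] recovers the start. *)
apply: (@inj_fun _ _ (fun p => ite (fst (e p) = emp) (e p) (inr (pr (snd (e p)) (snd p))))); first by dfn.
- move=> p /in_prd [z [n [hz [hn ->]]]].
  have := orbit_in hz hn. rewrite /e fst_pr snd_pr.
  case: (classic (fst (orbit z n) = emp)) => h; [rewrite (ite_true _ _ h)|rewrite (ite_false _ _ h)].
  + move=> H. have [a [ha ->]] := sum_inl H h. by apply/inl_in.
  + move=> /in_sum [[a [_ E]]|[a [ha ->]]]; first by case: h; rewrite E fst_inl.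
    by apply/inr_in/in_prd_pr; rewrite snd_pr.
- move=> p p' /in_prd [z [n [hz [hn ->]]]] /in_prd [z' [n' [hz' [hn' ->]]]].
  have H := orbit_in hz hn. have H' := orbit_in hz' hn'. rewrite /e !fst_pr !snd_pr.
  case: (classic (fst (orbit z n) = emp)) => h; [rewrite (ite_true _ _ h)|rewrite (ite_false _ _ h)];
  (case: (classic (fst (orbit z' n') = emp)) => h'; [rewrite (ite_true _ _ h')|rewrite (ite_false _ _ h')]).
  + by move=> E; have [-> ->] := orbit_inj hz hz' hn h hn' E.
  + by move=> E; case: (@fst_inr _ _ (pr (snd (orbit z' n')) n')); rewrite -E.
  + by move=> E; case: (@fst_inr _ _ (pr (snd (orbit z n)) n)); rewrite E.
  + move=> /inr_inj /pr_inj [E En]. subst n'. congr pr. apply: (orbit_inj_exit hz hz' hn).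
    move/in_sum: H => [[a [_ Ea]]|[a [_ Ea]]]; first by case: h; rewrite Ea fst_inl.
    move/in_sum: H' => [[a' [_ Ea']]|[a' [_ Ea']]]; first by case: h'; rewrite Ea' fst_inl.
    by move: E; rewrite Ea Ea' !snd_inr => ->.
Qed.

End Doubling.

Lemma ev_plent_prd_omega X al : plentiful X -> ord al -> eventual (prd (prd X al) omega).
Proof.
move=> pX oal. have [be [obe h]] := prd_omega_inj_ord oal.
apply: inj_ev (pX be obe). apply: (inj_trans (@inj_prdA _ _ _)). apply: inj_prd => //. exact: inj_refl.
Qed.

(** A copy of [Z + Z] outside [A1] injects into some [Z + X x be] by universality. Iterating gives
    an injection of [Z x omega] into [Z] plus omega copies of [X x be], which is eventual because
    [X] is plentiful. *)
Lemma cofinal_sizes A0 : SVC_A M ->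
  exists A1 Z X, sub A0 A1 /\
    (forall al, ord al -> eventual (prd (sum Z (prd X al)) omega)) /\
    forall B, outside B A1 -> exists al, ord al /\ inj B (sum Z (prd X al)).
Proof.
move=> /svc_chart [P chart]. have [A1 [Z [X [sA [eZ [pX univ]]]]]] := universal_family A0 chart.
exists A1, Z, X. split=> //; split=> // al oal.
apply: (inj_ev (@inj_prd_sum _ _ _)). apply: ev_sum; last exact: ev_plent_prd_omega.
have [B [oB iB]] := emb_outside (ev_sum eZ eZ A1).
have [be [obe hbe]] := univ B oB. have [f [f1 f2]] := inj_trans iB hbe.
apply: (inj_ev (inj_prd_omega f1 f2)). apply: ev_sum => //. exact: ev_plent_prd_omega.
Qed.

End Family.

(** * The hierarchy over a set of urelements, and automorphisms *)

Section Hierarchy.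
Context {M : ustruct} {HM : model M}.
Implicit Types (x y z a b f m n t p q u v A B E R X Y S w c : M).

(* The levels over the urelements in [A]; other elements of [A] are ignored. *)
Definition V_step A x f : M := cup (sep A (@ur M)) (union (rep x (fun y => pow (app f y)))).
Definition V : M -> M -> M := rec V_step.

Lemma def_V_step : fdef3 V_step.
Proof. unfold V_step; dfn. Qed.

Lemma def_V : fdef2 V.
Proof. exact: def_rec def_V_step. Qed.
#[local] Hint Resolve def_V : dfn.

Lemma V_eq A x : V A x = V_step A x (lam x (V A)).
Proof. exact: rec_eq def_V_step _ _. Qed.


Lemma in_V A x z : z ∈ V A x <->
  (z ∈ A /\ ur z) \/ exists y, y ∈ x /\ is_set z /\ sub z (V A y).
Proof.
have D : fdef1 (fun y => pow (app (lam x (V A)) y)) by dfn.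
have E : z ∈ union (rep x (fun y => pow (app (lam x (V A)) y))) <->
    exists y, y ∈ x /\ is_set z /\ sub z (V A y).
  rewrite in_union; split.
    move=> [s []]; rewrite in_rep // => -[y [hy ->]] /in_pow. rewrite app_lam //; first by dfn.
    by exists y.
  move=> [y [hy h]]. exists (pow (V A y)). split; last exact/in_pow.
  by apply/in_rep => //; exists y; split=> //; rewrite app_lam //; dfn.
rewrite V_eq in_cup in_sep; first by dfn. by rewrite E.
Qed.

Lemma V_mono A A' x y : sub A A' -> sub x y -> sub (V A x) (V A' y).
Proof.
move=> hA. have W : forall x, sub (V A x) (V A' x).
  apply: eps_ind; first by dfn.
  move=> u IH z /in_V [[h1 h2]|[w [h1 [h2 h3]]]]; apply/in_V.
    by left; split=> //; exact: hA.
  by right; exists w; split=> //; split=> // v /h3; exact: IH.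
move=> hx z /W /in_V [h|[w [h1 h2]]]; apply/in_V; [by left|right].
by exists w; split=> //; exact: hx.
Qed.

Lemma V_trans A al y : ord al -> y ∈ V A al -> sub y (V A al).
Proof.
move=> oal /in_V [[_ h]|[be [h1 [_ h3]]]] z hz.
- by case: (ZFU_urelements model_ZFU h hz).
- move/h3: hz. apply: V_mono => //. exact: ord_sub.
Qed.

(** By membership induction: a common height for the elements is collected first, and then, at that
    height, a common set of urelements. *)
Lemma V_total x : exists A al, ord al /\ x ∈ V A al.
Proof.
move: x; apply: eps_ind; first by dfn.
move=> x IH. case: (classic (ur x)) => hx.
  exists (upair x x), emp. split; first exact: ord_emp.
  by apply/in_V; left; split=> //; apply/in_upair; left.
have [|||al [oal h1]] := @collect_ord _ _ (fun y al => exists A, y ∈ V A al) x; [by dfn| | |].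
    by move=> y /IH [A [al [h1 h2]]]; exists al; split=> //; exists A.
  by move=> y al be _ _ s [A h]; exists A; apply: V_mono h.
have [|||A h2] := @collect_set _ _ (fun y A => y ∈ V A al) x; [by dfn|exact: h1| |].
  by move=> y A A' s; apply: V_mono.
exists A, (suc al); split; first exact: ord_suc. apply/in_V; right.
by exists al; split=> //; apply/in_suc; right.
Qed.

(** Definability of the two maps allows membership induction on statements about them. *)
Record autom (s s' : M -> M) : Prop := Autom {
  autom_def : fdef1 s;
  autom_def' : fdef1 s';
  automK : forall x, s' (s x) = x;
  automKV : forall x, s (s' x) = x;
  autom_mem : forall x y, x ∈ y <-> s x ∈ s y;
  autom_ur : forall x, ur x <-> ur (s x)
}.

Lemma autom_inv s s' : autom s s' -> autom s' s.
Proof.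
move=> H; split; try by case: H.
- by move=> x y; rewrite (autom_mem H (s' x) (s' y)) !(automKV H).
- by move=> x; rewrite (autom_ur H (s' x)) (automKV H).
Qed.

Lemma autom_comp s s' r r' : autom s s' -> autom r r' ->
  autom (fun x => s (r x)) (fun x => r' (s' x)).
Proof.
move=> H K. have D1 := autom_def H. have D2 := autom_def' H.
have D3 := autom_def K. have D4 := autom_def' K.
split; [by dfn|by dfn| | | |].
- by move=> x; rewrite (automK H) (automK K).
- by move=> x; rewrite (automKV K) (automKV H).
- by move=> x y; rewrite (autom_mem K) (autom_mem H).
- by move=> x; rewrite (autom_ur K) (autom_ur H).
Qed.

Lemma autom_sat s s' phi (r : nat -> M) : autom s s' ->
  sat r phi <-> sat (fun i => s (r i)) phi.
Proof.
move=> H. elim: phi r => [i j|i j|i|p IH|p IHp q IHq|p IH] r /=.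
- exact: autom_mem H _ _.
- split=> [->//|E]. by rewrite -(automK H (r i)) E (automK H).
- exact: autom_ur H _.
- have := IH r; tauto.
- have := IHp r; have := IHq r; tauto.
- split=> -[a h].
  + exists (s a). move/IH: h. by apply: (proj1 (sat_ext _ _)) => -[|i].
  + exists (s' a). apply/IH. move: h.
    by apply: (proj1 (sat_ext _ _)) => -[|i] //=; rewrite (automKV H).
Qed.

Lemma autom_V s s' A A' : autom s s' -> (forall a, a ∈ A -> ur a -> s a ∈ A') ->
  forall al x, x ∈ V A al -> s x ∈ V A' al.
Proof.
move=> H hA. have D := autom_def H. apply: eps_ind; first by dfn.
move=> al IH x /in_V [[h1 h2]|[be [h1 [h2 h3]]]]; apply/in_V.
- by left; split; [exact: hA|exact: (proj1 (autom_ur H x))].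
- right; exists be; split=> //; split; first by move=> hu; apply: h2; exact: (proj2 (autom_ur H x)).
  move=> z. rewrite -(automKV H z) => /(proj2 (autom_mem H _ _)) hz. apply: IH => //. exact: h3.
Qed.

(** * The automorphism exchanging two disjoint sets of urelements *)

Section Swap.
Variables (E c : M).
Hypothesis c_ur : forall u, u ∈ E -> ur u /\ ur (app c u) /\ ~ app c u ∈ E.
Hypothesis c_inj : inj_code c E.

Definition swap_ur u : M :=
  ite (u ∈ E) (app c u) (ite (u ∈ img c E) (iota (fun v => v ∈ E /\ app c v = u)) u).
Definition swap_step p x f : M := ite (ur x) (swap_ur x) (rep x (app f)).
Definition swap : M -> M := rec swap_step emp.

Lemma def_swap_step : fdef3 swap_step.
Proof. unfold swap_step, swap_ur; dfn. Qed.

Lemma def_swap : fdef1 swap.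
Proof. have D := def_rec def_swap_step. unfold swap; dfn. Qed.
#[local] Hint Resolve def_swap : dfn.

Lemma swap_eq x : swap x = swap_step emp x (lam x swap).
Proof. exact: rec_eq def_swap_step _ _. Qed.


Lemma swap_on u : u ∈ E -> swap u = app c u.
Proof. by move=> h; rewrite swap_eq /swap_step ite_true; [case: (c_ur h)|exact: ite_true]. Qed.

Lemma swap_img u : u ∈ E -> swap (app c u) = u.
Proof.
move=> h. have [h1 [h2 h3]] := c_ur h. rewrite swap_eq /swap_step (ite_true _ _ h2).
rewrite /swap_ur (ite_false _ _ h3) ite_true; first by apply/in_img; exists u.
apply: iota_eq; split=> // v [hv E']. by apply: c_inj.
Qed.

Lemma swap_off u : ur u -> ~ u ∈ E -> ~ u ∈ img c E -> swap u = u.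
Proof.
move=> h1 h2 h3. by rewrite swap_eq /swap_step (ite_true _ _ h1) /swap_ur !ite_false.
Qed.

Lemma swap_cases u : ur u -> ur (swap u) /\ swap (swap u) = u.
Proof.
move=> hu. case: (classic (u ∈ E)) => h1.
  by rewrite (swap_on h1) (swap_img h1); case: (c_ur h1) => _ [].
case: (classic (u ∈ img c E)) => h2; last by rewrite !swap_off.
move/in_img: h2 => [v [hv ->]]. rewrite (swap_img hv) (swap_on hv). by case: (c_ur hv).
Qed.

Lemma in_swap x z : is_set x -> z ∈ swap x <-> exists y, y ∈ x /\ z = swap y.
Proof.
move=> sx. rewrite swap_eq /swap_step (ite_false _ _ sx) in_rep; first by dfn.
by split=> -[y [hy ->]]; exists y; split=> //; rewrite app_lam //; exact: def_swap.
Qed.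

Lemma swap_set x : is_set x -> is_set (swap x).
Proof. move=> sx. rewrite swap_eq /swap_step (ite_false _ _ sx). by apply: rep_set; dfn. Qed.

Lemma swapK : forall x, swap (swap x) = x.
Proof.
apply: eps_ind; first by dfn.
move=> x IH. case: (classic (ur x)) => hx; first by case: (swap_cases hx).
apply: set_ext => //; first by do 2!apply: swap_set.
move=> z. rewrite in_swap; first exact: swap_set. split.
- move=> [y [hy ->]]. move/(in_swap _ hx): hy => [w [hw ->]]. by rewrite IH.
- move=> hz. exists (swap z); split; last by rewrite IH.
  by apply/in_swap => //; exists z.
Qed.

Lemma swap_mem x y : x ∈ y -> swap x ∈ swap y.
Proof. move=> h; apply/in_swap; [exact: mem_set h|by exists x]. Qed.

Lemma swap_autom : autom swap swap.
Proof.
split; try exact: def_swap; try exact: swapK.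
- by move=> x y; split=> [|/swap_mem]; [exact: swap_mem|rewrite !swapK].
- move=> x; split=> h; first by case: (swap_cases h).
  by case: (classic (ur x)) => // /swap_set.
Qed.

End Swap.

(* Through a third disjoint copy of [E], a partial injection of the urelements
   outside [A1] extends to an automorphism fixing [A1]. *)
Lemma homogeneous A1 E b : eventual E -> outside E A1 ->
  (forall u, u ∈ E -> ur (app b u) /\ ~ app b u ∈ A1) -> inj_code b E ->
  exists s s', autom s s' /\ (forall u, u ∈ E -> s u = app b u) /\
    (forall u, u ∈ A1 -> ur u -> s u = u).
Proof.
move=> evE oE hb injb.
(* [E] and its image under [b] may overlap, so they cannot be swapped directly; the third copy
   avoids both of them and [A1]. *)
have [c [c1 c2]] := evE (cup A1 (cup E (img b E))).
have c1' u : u ∈ E -> ur (app c u) /\ ~ app c u ∈ A1 /\ ~ app c u ∈ E /\ ~ app c u ∈ img b E.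
  move=> /c1 [h1 h2]; split=> //.
  by split; [|split] => h; apply: h2; rewrite !in_cup; auto.
have hc u : u ∈ E -> ur u /\ ur (app c u) /\ ~ app c u ∈ E.
  by move=> h; case: (c1' u h) => h1 [h2 [h3 h4]]; split=> //; case: (oE u h).
have D := def_swap E c.
have D' : fdef1 (fun w => app b (swap E c w)) by dfn.
have swE w : w ∈ img c E -> swap E c w ∈ E /\ w = app c (swap E c w).
  by move=> /in_img [u [hu ->]]; rewrite swap_img.
(* [d] carries the third copy on to the image of [b], so the two swaps send [u] to [app c u] and
   then to [app b u]. *)
pose (d := lam (img c E) (fun w => app b (swap E c w))).
have dE w : w ∈ img c E -> app d w = app b (swap E c w) by move=> h; rewrite app_lam.
have hd w : w ∈ img c E -> ur w /\ ur (app d w) /\ ~ app d w ∈ img c E.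
  move=> h; rewrite (dE w h). have [h1 h2] := swE w h. split; [|split].
      by rewrite h2; case: (c1' _ h1).
    by case: (hb _ h1).
  move=> /in_img [u [hu E']]. case: (c1' u hu) => _ [_ [_]]; apply.
  by apply/in_img; exists (swap E c w).
have injd : inj_code d (img c E).
  move=> w w' h h'. rewrite (dE w h) (dE w' h') => E'.
  have [h1 h2] := swE w h. have [h1' h2'] := swE w' h'.
  by rewrite h2 h2' (injb _ _ h1 h1' E').
exists (fun x => swap (img c E) d (swap E c x)), (fun x => swap E c (swap (img c E) d x)).
split; [|split].
- exact: autom_comp (swap_autom hd injd) (swap_autom hc c2).
- move=> u hu. have hcu : app c u ∈ img c E by apply/in_img; exists u.
  rewrite (swap_on hc hu) (swap_on hd hcu) (dE _ hcu). by rewrite (swap_img hc c2 hu).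
- move=> u hu uu.
  have n1 : ~ u ∈ E by move=> h; case: (oE u h).
  have n2 : ~ u ∈ img c E.
    by move=> /in_img [v [hv E']]; case: (c1' v hv) => _ []; rewrite -E'.
  rewrite (@swap_off E c u) //. apply: swap_off => //.
  move=> /in_img [w [hw E']]. have [h1 _] := swE w hw. case: (hb _ h1) => _; apply.
  by rewrite -dE // -E'.
Qed.

End Hierarchy.
#[export] Hint Resolve def_V : dfn.

(** * Reflection *)

(** The matrices of the existential subformulas, for which the Tarski-Vaught criterion is to be
    checked. *)
Fixpoint bodies (phi : form) : list form :=
  match phi with
  | FMem _ _ | FEq _ _ | FUr _ => nil
  | FNot p => bodies p
  | FAnd p q => (bodies p ++ bodies q)%list
  | FEx p => p :: bodies p
  end.

Lemma free_bound (phi : form) : exists k, forall i, free i phi -> i < k.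
Proof.
elim: phi => [i j|i j|i|p [k IH]|p [k IHp] q [l IHq]|p [k IH]] /=.
- by exists (S (i + j)) => u; lia.
- by exists (S (i + j)) => u; lia.
- by exists (S i) => u; lia.
- by exists k.
- by exists (k + l) => u [/IHp|/IHq]; lia.
- by exists k => i /IH; lia.
Qed.

Lemma free_bound_list (ps : list form) :
  exists k, forall p, In p ps -> forall i, free i p -> i < k.
Proof.
elim: ps => [|p ps [k IH]]; first by exists 0.
have [l hl] := free_bound p. exists (k + l) => q [<-|/IH h] i hi.
- have := hl i hi; lia.
- have := h i hi; lia.
Qed.

(** [d] counts the binders passed, so [t] is always variable [d] of [r']. At a quantifier the
    criterion moves a witness into [t], and the induction hypothesis applies to it. *)
Lemma tarski_vaught (M : ustruct) (t : M) (phi : form) :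
  (forall p, In p (bodies phi) -> forall r : nat -> M, (forall i, r i ∈ t) ->
     (exists y, sat (y .: r) p) -> exists y, y ∈ t /\ sat (y .: r) p) ->
  forall d (r r' : nat -> M), (forall i, free i phi -> r' (bump d i) = r i) -> r' d = t ->
    (forall i, r i ∈ t) -> sat r phi <-> sat r' (relativize_at d phi).
Proof.
elim: phi => [i j|i j|i|p IH|p IHp q IHq|p IH] TV d r r' E Et T /=.
- rewrite !E //=; by auto.
- rewrite !E //=; by auto.
- by rewrite E.
- have := IH TV d r r' E Et T; tauto.
- have := IHp (fun p h => TV p (in_or_app _ _ _ (or_introl h))) d r r' (fun i h => E i (or_introl h)) Et T.
  have := IHq (fun p h => TV p (in_or_app _ _ _ (or_intror h))) d r r' (fun i h => E i (or_intror h)) Et T.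
  tauto.
- have K a : a ∈ t -> sat (a .: r) p <-> sat (a .: r') (relativize_at (S d) p).
    move=> ha. apply: IH => //.
        by move=> q h; apply: TV; right.
      move=> [|i] hi; first by []. have := E i hi. by rewrite /bump /=; case: Nat.ltb_spec; case: Nat.ltb_spec => //=; lia.
    by case.
  split=> [h|[a [ha h]]].
  + have [a [ha h']] := TV p (or_introl eq_refl) r T h.
    exists a. rewrite Et. by split=> //; apply/K.
  + exists a. apply/K => //. by rewrite Et in ha.
Qed.

(** * Coded tuples of parameters and sets containing witnesses for them *)

Section Tuples.
Context {M : ustruct} {HM : model M}.
Implicit Types (x y z t T : M).

Fixpoint tuples (k : nat) T : M :=
  match k with 0 => suc emp | S k => prd T (tuples k T) end.

Fixpoint coord x (i : nat) : M :=
  match i with 0 => fst x | S i => coord (snd x) i end.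

Lemma def_tuples k : fdef1 (tuples k).
Proof. elim: k => [|k IH] /=; dfn. Qed.

Lemma def_coord i : fdef1 (fun x => coord x i).
Proof. elim: i => [|i IH] /=; [dfn|exact: (d_tapp1 IH (d_tapp1 def_snd (d_tvar 0)))]. Qed.

Lemma tuples_coord k T x i : x ∈ tuples k T -> i < k -> coord x i ∈ T.
Proof.
elim: k x i => [|k IH] x i /=; first by lia.
move=> /in_prd [a [y [ha [hy ->]]]]. case: i => [|i] hi /=; first by rewrite fst_pr.
rewrite snd_pr. apply: IH => //. lia.
Qed.

Lemma tuples_code k T (r : nat -> M) : (forall i, i < k -> r i ∈ T) ->
  exists x, x ∈ tuples k T /\ forall i, i < k -> coord x i = r i.
Proof.
elim: k r => [|k IH] r h /=.
- exists emp; split; [by apply/in_suc; right|lia].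
- have [|x [h1 h2]] := IH (fun i => r (S i)); first by move=> i hi; apply: h; lia.
  exists (pr (r 0) x); split; first by apply/in_prd_pr; split=> //; apply: h; lia.
  move=> [|i] hi /=; [by rewrite fst_pr|rewrite snd_pr; apply: h2; lia].
Qed.

(** A finite conjunction by recursion on the external list, so that its definability follows by
    induction. *)
Fixpoint witnessed (ps : list form) x T : Prop :=
  match ps with
  | nil => True
  | p :: ps => ((exists y, sat (y .: coord x) p) -> exists y, y ∈ T /\ sat (y .: coord x) p)
      /\ witnessed ps x T
  end.

Lemma witnessed_in ps x T : witnessed ps x T <->
  forall p, In p ps -> (exists y, sat (y .: coord x) p) -> exists y, y ∈ T /\ sat (y .: coord x) p.
Proof.
elim: ps => [|p ps IH] /=; first by split.
rewrite IH. split; first by move=> [h1 h2] q [<-|]; [exact: h1|exact: h2].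
by move=> h; split; [apply: h; left|move=> q hq; apply: h; right].
Qed.

Lemma def_sat_dec p : def2 (fun y x => sat (y .: coord x) p).
Proof.
apply: (d_ext (P := fun r => sat (fun i => (fun j r => match j with 0 => r 0 | S j => coord (r 1) j end) i r) p)).
- apply: d_sat => -[|i]; first by dfn. have D := def_coord i. exact: (d_tapp1 D (d_tvar 1)).
- by move=> r; apply: sat_ext => -[|i].
Qed.

Lemma def_witnessed ps : def2 (witnessed ps).
Proof.
elim: ps => [|p ps IH] /=; first by unfold def2; dfn.
have D := def_sat_dec p.
have D1 : def1 (fun x => exists y, sat (y .: coord x) p).
  apply: (@d_ex _ (fun r y => sat (y .: coord (r 0)) p)).
  exact: (d_app2 D (d_tvar 0) (d_tvar 1)).
have D2 : def2 (fun x T => exists y, y ∈ T /\ sat (y .: coord x) p).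
  apply: (@d_ex _ (fun r y => y ∈ r 1 /\ sat (y .: coord (r 0)) p)). apply: d_and; first by dfn.
  exact: (d_app2 D (d_tvar 0) (d_tvar 1)).
apply: d_and; last exact: IH.
apply: d_imp; last exact: D2. exact: (d_app1 D1 (d_tvar 0)).
Qed.

Lemma witnessed_mono ps x T T' : sub T T' -> witnessed ps x T -> witnessed ps x T'.
Proof.
move=> s /witnessed_in h; apply/witnessed_in => p hp /(h p hp) [y [/s h1 h2]]. by exists y.
Qed.

Lemma witnessed_exists ps x : exists T, witnessed ps x T.
Proof.
elim: ps => [|p ps [T IH]] /=; first by exists emp.
case: (classic (exists y, sat (y .: coord x) p)) => [[y hy]|n]; last by exists T; split.
exists (cup T (upair y y)); split.
- by move=> _; exists y; split=> //; apply/in_cup; right; apply/in_upair; left.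
- apply: witnessed_mono IH => z hz; apply/in_cup; by left.
Qed.

End Tuples.
#[export] Hint Resolve def_tuples def_witnessed : dfn.

(** * Stages over copies of [Y(alpha)], here [size al], and their union *)

Section Reflection.
Context {M : ustruct} {HM : model M}.
Implicit Types (x y z a b f h m n t p q u v A B E R X Y S w c al be : M).
Variables (A1 Z X : M) (ps : list form) (k : nat).
Hypothesis ps_free : forall p : form, In p ps -> forall i, free (S i) p -> i < k.
Hypothesis sizes_ev : forall al, ord al -> eventual (prd (sum Z (prd X al)) omega).
Hypothesis sizes_cofinal : forall B, outside B A1 -> exists al, ord al /\ inj B (sum Z (prd X al)).

Definition size al : M := sum Z (prd X al).

Definition chart h al : Prop :=
  (forall z, z ∈ prd (size al) omega -> ur (app h z) /\ ~ app h z ∈ A1) /\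
  inj_code h (prd (size al) omega).

(** As a von Neumann number, [n] is the set of indices of the first [n] copies. *)
Definition atoms h n al : M := cup A1 (img h (prd (size al) n)).
Definition stage h n al : M := V (atoms h n al) al.

(** The demand is made of every chart, so the notion depends on no particular one, and a least good
    ordinal can be taken without choosing charts. *)
Definition good n al be : Prop := sub al be /\
  forall h, chart h be -> forall x, x ∈ tuples k (stage h n al) ->
    witnessed ps x (stage h (suc n) be).

Lemma def_size : fdef1 size.
Proof. unfold size; dfn. Qed.
#[local] Hint Resolve def_size : dfn.
Lemma def_chart : def2 chart.
Proof. unfold chart; dfn. Qed.
Lemma def_atoms : fdef3 atoms.
Proof. unfold atoms; dfn. Qed.
#[local] Hint Resolve def_chart def_atoms : dfn.
Lemma def_stage : fdef3 stage.
Proof. unfold stage; dfn. Qed.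
#[local] Hint Resolve def_stage : dfn.
Lemma def_good : def3 good.
Proof. unfold good; dfn. Qed.
#[local] Hint Resolve def_good : dfn.

Lemma size_sub al be : sub al be -> sub (size al) (size be).
Proof.
move=> s z /in_sum [[a [ha ->]]|[b [/in_prd [c [d [hc [hd ->]]]] ->]]].
- by apply/inl_in.
- by apply/inr_in/in_prd_pr; split=> //; exact: s.
Qed.

Lemma prd_size_sub al be n m : sub al be -> sub n m -> sub (prd (size al) n) (prd (size be) m).
Proof.
move=> s s' z /in_prd [a [b [ha [hb ->]]]]. apply/in_prd_pr; split; [exact: size_sub s _ ha|exact: s'].
Qed.

Lemma atoms_sub h n m al be : sub al be -> sub n m -> sub (atoms h n al) (atoms h m be).
Proof.
move=> s s' z /in_cup [hz|/in_img [a [ha ->]]]; apply/in_cup; [by left|right].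
apply/in_img; exists a; split=> //. exact: prd_size_sub s s' _ ha.
Qed.

Lemma stage_sub h n m al be : sub al be -> sub n m -> sub (stage h n al) (stage h m be).
Proof. move=> s s'. apply: V_mono => //. exact: atoms_sub. Qed.

Lemma chart_anti h al be : sub al be -> chart h be -> chart h al.
Proof.
move=> s [h1 h2]. have s' := @prd_size_sub al be omega omega s (fun z hz => hz).
split; first by move=> z /s'; exact: h1.
by move=> a b /s' ha /s' hb; exact: h2.
Qed.

Lemma chart_exists al : ord al -> exists h, chart h al.
Proof. by move=> /sizes_ev /(_ A1) [h hh]; exists h. Qed.

(* Collect witnesses for one chart [h0]; given another chart [h], move the
   collected set by an automorphism that carries [h0] to [h] and sends the new
   urelements into the fresh copy with index [n]. *)
Lemma good_exists n al : n ∈ omega -> ord al -> exists be, ord be /\ good n al be.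
Proof.
move=> hn oal. have [h0 [h01 h02]] := chart_exists oal.
have sn : sub n omega by exact: omega_trans hn.
have sp : sub (prd (size al) n) (prd (size al) omega) by apply: prd_size_sub.
pose (D0 := img h0 (prd (size al) n)).
have [|||W HW] := @collect_set _ _ (fun x A => witnessed ps x A) (tuples k (stage h0 n al)); [by dfn| | |].
    by move=> x _; exact: witnessed_exists.
  by move=> x A A'; exact: witnessed_mono.
have [C [mu [omu hWC]]] := V_total W.
have WC : sub W (V C mu) by exact: V_trans.
have dB : def1 (fun u => ur u /\ ~ u ∈ A1 /\ ~ u ∈ D0) by dfn.
(* These are the urelements that the witnesses need beyond [A1] and the first [n] copies under [h0];
   [sizes_cofinal] makes room for them. *)
pose (B := sep C (fun u => ur u /\ ~ u ∈ A1 /\ ~ u ∈ D0)).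
have inB u : u ∈ B <-> u ∈ C /\ ur u /\ ~ u ∈ A1 /\ ~ u ∈ D0 by exact: in_sep.
have [|eta [oeta [g [g1 g2]]]] := @sizes_cofinal B; first by move=> u /inB [_ [h1 [h2 _]]].
pose (be := cup al (cup eta mu)).
have obe : ord be by apply: ord_cup => //; exact: ord_cup.
have sal : sub al be by move=> z hz; apply/in_cup; left.
have seta : sub eta be by move=> z hz; apply/in_cup; right; apply/in_cup; left.
have smu : sub mu be by move=> z hz; apply/in_cup; right; apply/in_cup; right.
exists be; split=> //; split=> // h [h1 h2] x hx.
pose (E := cup D0 B).
(* Old urelements return to their positions under [h0], and new ones go to the copy with index [n].
   Since [n] is not an element of itself, the two kinds do not collide. *)
pose (F := fun u : M => ite (u ∈ D0) (iota (fun z => z ∈ prd (size al) n /\ app h0 z = u)) (pr (app g u) n)).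
have DF : fdef1 F by unfold F; dfn.
have FD z : z ∈ prd (size al) n -> F (app h0 z) = z.
  move=> hz. have hD : app h0 z ∈ D0 by apply/in_img; exists z.
  rewrite /F (ite_true _ _ hD). apply: iota_eq; split=> // z' [hz' E'].
  by apply: h02 => //; exact: sp.
have FB u : u ∈ B -> F u = pr (app g u) n.
  by move=> /inB [_ [_ [_ nD]]]; rewrite /F (ite_false _ _ nD).
have Ecases u : u ∈ E -> (exists z, z ∈ prd (size al) n /\ u = app h0 z) \/ u ∈ B.
  by move=> /in_cup [/in_img|]; [left|right].
have n_suc : n ∈ suc n by apply/in_suc; right.
have ssuc : sub n (suc n) by move=> z hz; apply/in_suc; left.
have Fsuc u : u ∈ E -> F u ∈ prd (size be) (suc n).
  move=> /Ecases [[z [hz ->]]|hu].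
    by rewrite FD //; apply: prd_size_sub sal ssuc _ hz.
  rewrite FB //. apply/in_prd_pr; split=> //. exact: (size_sub seta (g1 u hu)).
have sO : sub (prd (size be) (suc n)) (prd (size be) omega).
  apply: prd_size_sub => //. exact: omega_trans (omegaS hn).
have nB z u : z ∈ prd (size al) n -> u ∈ B -> z <> F u.
  move=> hz hu. rewrite (FB u hu) => E'. move: hz; rewrite E' => /in_prd_pr [_]. exact: mem_irr.
have Finj u v : u ∈ E -> v ∈ E -> F u = F v -> u = v.
  move=> /Ecases [[z [hz ->]]|hu] /Ecases [[z' [hz' ->]]|hv].
        by rewrite !FD // => ->.
      by rewrite FD // => E'; case: (nB z v hz hv).
    by rewrite (FD z') // => E'; case: (nB z' u hz' hu).
  by rewrite !FB // => /pr_inj [E' _]; apply: g2.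
have Db : fdef1 (fun u => app h (F u)) by dfn.
pose (b := lam E (fun u => app h (F u))).
have bE u : u ∈ E -> app b u = app h (F u) by move=> hu; rewrite app_lam.
have Fom u : u ∈ E -> F u ∈ prd (size be) omega by move=> hu; apply/sO/Fsuc.
have [||||s [s' [As [sE sA]]]] := @homogeneous _ _ A1 E b.
      by apply: inj_ev (sizes_ev obe); apply: (@inj_fun _ _ F).
    by move=> u /Ecases [[z [hz ->]]|/inB [_ [hu [hu' _]]]] //; exact/h01/sp.
  1: by move=> u hu; rewrite bE //; exact/h1/Fom.
  move=> u v hu hv; rewrite !bE // => E'. apply: Finj => //. by apply: h2 => //; exact: Fom.
have in_E z : z ∈ prd (size al) n -> app h0 z ∈ E.
  by move=> hz; apply/in_cup; left; apply/in_img; exists z.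
have s'stage y : y ∈ stage h n al -> s' y ∈ stage h0 n al.
  apply: (autom_V (autom_inv As)) => u /in_cup [hu|/in_img [z [hz ->]]] uu; apply/in_cup.
    by left; rewrite -{1}(sA u hu uu) (automK As).
  right. have E' : s (app h0 z) = app h z by rewrite sE ?bE ?FD //; exact: in_E.
  by rewrite -E' (automK As); apply/in_img; exists z.
have sstage y : y ∈ V C mu -> s y ∈ stage h (suc n) be.
  move=> hy. apply: (V_mono (A := atoms h (suc n) be) (x := mu)) => //.
  move: hy; apply: (autom_V As) => u hu uu.
  case: (classic (u ∈ A1)) => hA; first by rewrite sA //; apply/in_cup; left.
  have uE : u ∈ E.
    apply/in_cup. case: (classic (u ∈ D0)) => hD; [by left|right]. by apply/inB.
  apply/in_cup; right. rewrite sE // bE //. by apply/in_img; exists (F u); split=> //; exact: Fsuc.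
(* The tuple is pulled back along [s'] to the stage of [h0]; the witness found in [W] is then pushed
   forward along [s]. *)
have [x' [hx' Ex']] := @tuples_code _ _ k (stage h0 n al) (fun i => s' (coord x i))
  (fun i hi => s'stage _ (tuples_coord hx hi)).
have W' := HW x' hx'.
apply/witnessed_in => p hp [y hy]. move/witnessed_in: W' => /(_ p hp) [|w [hw wit]].
  exists (s' y). move/(autom_sat _ _ (autom_inv As)): hy.
  apply: (proj1 (sat_free_ext _)) => -[|i] hi //=. by rewrite Ex' //; exact: ps_free hi.
exists (s w). split; first exact/sstage/WC.
move/(autom_sat _ _ As): wit.
apply: (proj1 (sat_free_ext _)) => -[|i] hi //=. rewrite Ex'; first exact: ps_free hi.
exact: automKV As _.
Qed.

Definition next n al : M := least (fun be => good n al be).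

Lemma def_next : fdef2 next.
Proof. unfold next, least; dfn. Qed.
#[local] Hint Resolve def_next : dfn.

Lemma next_spec n al : n ∈ omega -> ord al -> ord (next n al) /\ good n al (next n al).
Proof.
move=> hn oal. have [be [obe hbe]] := good_exists hn oal.
have [|h _] := @least_spec _ _ (fun be => good n al be) be _ obe hbe; first by dfn.
exact: h.
Qed.

(** Joining [al] with the bounds from all earlier steps makes the heights increase, whatever the
    monotonicity of [next]. *)
Definition height_step al n f : M := cup al (union (rep n (fun m => next m (app f m)))).
Definition height : M -> M -> M := rec height_step.

Lemma def_height_step : fdef3 height_step.
Proof. unfold height_step; dfn. Qed.

Lemma def_height : fdef2 height.
Proof. exact: def_rec def_height_step. Qed.
#[local] Hint Resolve def_height : dfn.

Lemma height_eq al n :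
  height al n = cup al (union (rep n (fun m => next m (height al m)))).
Proof.
rewrite {1}/height rec_eq; first exact: def_height_step.
have D : fdef1 (fun m => next m (app (lam n (height al)) m)) by dfn.
have D' : fdef1 (fun m => next m (height al m)) by dfn.
congr (cup _ (union _)). apply: rep_ext => // m hm. by rewrite app_lam //; dfn.
Qed.

Lemma in_height al n z : z ∈ height al n <->
  z ∈ al \/ exists m, m ∈ n /\ z ∈ next m (height al m).
Proof.
have D : fdef1 (fun m => next m (height al m)) by dfn.
rewrite height_eq in_cup in_union.
split=> -[h|[y [h1 h2]]]; [by left| |by left|]; right.
- by move: h1 h2; rewrite in_rep // => -[m [hm ->]]; exists m.
- by exists (next y (height al y)); split=> //; apply/in_rep => //; exists y.
Qed.

Lemma ord_height al n : ord al -> n ∈ omega -> ord (height al n).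
Proof.
move=> oal. move: n. apply: eps_ind; first by dfn.
move=> n IH hn.
have oN m : m ∈ n -> ord (next m (height al m)).
  move=> hm. have hm' := omega_trans hn hm. by case: (next_spec hm' (IH m hm hm')).
have D : fdef1 (fun m => next m (height al m)) by dfn.
rewrite height_eq. apply: ord_cup => //. apply: ord_union => a. rewrite in_rep // => -[m [hm ->]]. exact: oN.
Qed.

Lemma next_height al n : sub (next n (height al n)) (height al (suc n)).
Proof. by move=> z hz; apply/in_height; right; exists n; split=> //; apply/in_suc; right. Qed.

Lemma height_sub al n m : sub n m -> sub (height al n) (height al m).
Proof.
move=> s z /in_height [h|[l [hl h]]]; apply/in_height; [by left|right].
by exists l; split=> //; exact: s.
Qed.

Lemma nat_sub_total n m : n ∈ omega -> m ∈ omega -> sub n m \/ sub m n.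
Proof.
move=> hn hm. have [h|h] := ord_sub_or (nat_ord hn) (nat_ord hm); [by left|right].
exact: nat_trans hn _ h.
Qed.

(** A single chart for the supremum [lambda] restricts to a chart for every height. Each stage
    therefore finds its witnesses in the following stage over this same chart, and the union of the
    stages is closed under witnesses. *)
Lemma reflecting_set x al : ord al -> x ∈ V A1 al -> exists t, transitive_set t /\ x ∈ t /\
  forall p : form, In p ps -> forall r : nat -> M, (forall i, r i ∈ t) ->
    (exists y, sat (y .: r) p) -> exists y, y ∈ t /\ sat (y .: r) p.
Proof.
move=> oal hx.
have Dh : fdef1 (height al) by dfn.
pose (lambda := union (rep omega (height al))).
have olam : ord lambda.
  by apply: ord_union => a; rewrite in_rep // => -[n [hn ->]]; exact: ord_height.
have slam n : n ∈ omega -> sub (height al n) lambda.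
  by move=> hn z hz; apply/in_union; exists (height al n); split=> //; apply/in_rep => //; exists n.
have [h hh] := chart_exists olam.
pose (T := fun n : M => stage h n (height al n)).
have DT : fdef1 T by unfold T; dfn.
have Tmono n m : sub n m -> sub (T n) (T m).
  by move=> s; apply: stage_sub => //; exact: height_sub.
pose (t := union (rep omega T)).
have in_t z : z ∈ t <-> exists n, n ∈ omega /\ z ∈ T n.
  rewrite in_union; split.
    by move=> [y []]; rewrite in_rep // => -[n [hn ->]] hz; exists n.
  by move=> [n [hn hz]]; exists (T n); split=> //; apply/in_rep => //; exists n.
exists t. split; [split; first exact: union_set|split].
- move=> y /in_t [n [hn hy]] z hz. apply/in_t; exists n; split=> //.
  exact: V_trans (ord_height oal hn) hy z hz.
- apply/in_t; exists emp; split; first exact: omega0.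
  move: hx; apply: V_mono => z hz; first by apply/in_cup; left. by apply/in_height; left.
- move=> p hp r hr hy.
  (* Only the first [k] values matter; the stages increase, so finitely many values lie in a common
     one. *)
  have [n [hn Hn]] : exists n, n ∈ omega /\ forall i, i < k -> r i ∈ T n.
    elim: (k) => [|l [n [hn Hn]]]; first by exists emp; split; [exact: omega0|lia].
    have [m [hm Hm]] := proj1 (in_t _) (hr l).
    have [s|s] := nat_sub_total hn hm.
      exists m; split=> // i hi. case: (Nat.eq_dec i l) => [->//|ne].
      by apply: (Tmono _ _ s); apply: Hn; lia.
    exists n; split=> // i hi. case: (Nat.eq_dec i l) => [->|ne]; first exact: (Tmono _ _ s).
    apply: Hn; lia.
  have [u [hu Eu]] := tuples_code Hn.
  have on := ord_height oal hn.
  have [oN [sN HN]] := next_spec hn on.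
  have hhN : chart h (next n (height al n)).
    apply: chart_anti hh => z hz. apply: (slam _ (omegaS hn)). exact: next_height.
  have := HN h hhN u hu. move/witnessed_in => /(_ p hp) [|w [hw wit]].
    move: hy => [y hy]; exists y; move: hy.
    apply: (proj1 (sat_free_ext _)) => -[|i] hi //=. by rewrite Eu //; exact: ps_free hi.
  exists w; split.
    apply/in_t; exists (suc n); split; first exact: omegaS.
    move: hw; apply: stage_sub => //. exact: next_height.
  move: wit. apply: (proj1 (sat_free_ext _)) => -[|i] hi //=. by rewrite Eu //; exact: ps_free hi.
Qed.

End Reflection.

Theorem theorem2p15 (M : ustruct) :
  ZFU M -> SVC_A M -> Collection M -> RP M.
Proof.
move=> HZ HS HC phi x. have HM : model M by split.
have [k hk] := free_bound_list (bodies phi).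
have [A0 [al [oal hx]]] := V_total x.
(* [A1] is chosen to include [A0], so that [x] lies in the hierarchy over [A1]. *)
have [A1 [Z [X [sA [sev scof]]]]] := cofinal_sizes A0 HS.
have hk' (p : form) : In p (bodies phi) -> forall i, free (S i) p -> i < k.
  by move=> hp i hi; have := hk p hp (S i) hi; lia.
have hx' : x ∈ V A1 al by move: hx; exact: V_mono.
have [t [tt [xt TV]]] := reflecting_set hk' sev scof oal hx'.
exists t; split; [|split] => //.
  by move=> z hz; case: tt => _ /(_ x xt z hz).
move=> r hr.
(* The criterion wants every variable to take a value in [t]. Those that do not are reset to [x], an
   element of [t]; they are not free in [phi]. *)
pose (r' := fun i => match excluded_middle_informative (r i ∈ t) with left _ => r i | right _ => x end).
have r't i : r' i ∈ t by rewrite /r'; case: excluded_middle_informative.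
have Er i : free i phi -> r i = r' i.
  by move=> /hr h; rewrite /r'; case: excluded_middle_informative.
rewrite (sat_free_ext Er). apply: (tarski_vaught TV) => //.
Qed.
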